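(* Let $\mu,\nu$ be permutons. There is a unique permuton $\mu\star\nu$ such that $$\mathbf H_{\mu\star\nu}(x,y)=\min_{0\le\gamma\le1}\left(\mathbf H_\mu(\gamma,y)+\mathbf H_\nu(x,\gamma)\right)$$ for all $x,y\in[0,1]$. Moreover, if $(u_n)_{n\ge1}$ and $(v_n)_{n\ge1}$ are sequences with $u_n,v_n\in\mathfrak S_n$ such that $(\pi_{u_n})_{n\ge1}$ converges weakly to $\mu$ and $(\pi_{v_n})_{n\ge1}$ converges weakly to $\nu$, then the sequence $(\pi_{u_n\star v_n})_{n\ge1}$ converges weakly to $\mu\star\nu$.
   Context: A permuton is a probability measure $\mu$ on $[0,1]^2$ with uniform marginals: $\mu([0,1]\times[a,b])=\mu([a,b]\times[0,1])=b-a$ for $0\le a\le b\le1$. Its height function is $\mathbf H_\mu(x,y)=\mu([x,1]\times[0,y])$. For $u$ in the symmetric group $\mathfrak S_n$, $\pi_u$ is the permuton with constant density $n$ on each of the squares $[\frac{i-1}{n},\frac in]\times[\frac{u(i)-1}{n},\frac{u(i)}{n}]$, $1\le i\le n$, and density $0$ elsewhere. On $\mathfrak S_n$, $\star$ denotes the Demazure product: with $s_i=(i\;\,i+1)$, let $\tau_i(u)=us_i$ if $u(i)<u(i+1)$ and $\tau_i(u)=u$ otherwise; $\star$ is the unique associative product on $\mathfrak S_n$ satisfying $u\star s_i=\tau_i(u)$ for all $u\in\mathfrak S_n$ and $1\le i\le n-1$. *)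

(* Defs.v *)
From HB Require Import structures.
From mathcomp Require Import all_boot all_order all_algebra all_fingroup.
From mathcomp Require Import all_classical all_reals all_analysis.
From mathcomp Require Import zify.

Set Implicit Arguments.
Unset Strict Implicit.
Unset Printing Implicit Defensive.

Import Order.TTheory GRing.Theory Num.Theory.
Import numFieldNormedType.Exports.

Local Open Scope classical_set_scope.
Local Open Scope ring_scope.

(* The minimum of a set, i.e. an infimum that is attained. *)
Definition is_min d (T : porderType d) (A : set T) (m : T) : Prop :=
  A m /\ lbound A m.

(* The plane with its Borel sigma-algebra. *)
Notation plane R := (measurableTypeR R * measurableTypeR R)%type.

Section Permutons.
Context {R : realType}.

Definition unit_square : set (plane R) := `[0, 1] `*` `[0, 1].

(* A probability measure on [0,1]^2 is encoded as a Borel probability measure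
   on R^2; taking a = 0 and b = 1 shows that it is carried by [0,1]^2. *)
Definition is_permuton (mu : probability (plane R) R) : Prop :=
  forall a b : R, 0 <= a -> a <= b -> b <= 1 ->
    mu (`[0, 1] `*` `[a, b]) = (b - a)%:E /\
    mu (`[a, b] `*` `[0, 1]) = (b - a)%:E.

Definition height (mu : set (plane R) -> \bar R) (x y : R) : \bar R :=
  mu (`[x, 1] `*` `[0, y]).

(* rho satisfies the requirements that characterize the permuton mu * nu. *)
Definition is_demazure_permuton (mu nu rho : probability (plane R) R) :
    Prop :=
  is_permuton rho /\
  forall x y : R, 0 <= x <= 1 -> 0 <= y <= 1 ->
    is_min [set (height mu g y + height nu x g)%E | g in `[0, 1]]
           (height rho x y).

(* Weak convergence on the compact space [0,1]^2, tested against all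
   continuous functions [0,1]^2 -> R. *)
Definition weak_cvg (mu_ : nat -> {measure set (plane R) -> \bar R})
    (mu : {measure set (plane R) -> \bar R}) : Prop :=
  forall f : R * R -> R, {within unit_square, continuous f} ->
    (\int[mu_ n]_(z in unit_square) (f z)%:E)%E @[n --> \oo] -->
    (\int[mu]_(z in unit_square) (f z)%:E)%E.

(* Ordinals start at 0, so the i-th square has lower left corner
   (i / n, u i / n). *)
Definition perm_square n (u : 'S_n) (i : 'I_n) : set (plane R) :=
  `[i%:R / n%:R, i.+1%:R / n%:R] `*` `[(u i)%:R / n%:R, (u i).+1%:R / n%:R].

Definition perm_support n (u : 'S_n) : set (plane R) :=
  \bigcup_(i in [set: 'I_n]) perm_square u i.

Lemma measurable_perm_support n (u : 'S_n) : measurable (perm_support u).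
Proof.
apply: fin_bigcup_measurable; first exact: finite_finset.
by move=> i _; apply: measurableX; exact: measurable_itv.
Qed.

(* The measure with density n on perm_support u and 0 elsewhere with respect to
   the two-dimensional Lebesgue measure. *)
Definition perm_permuton n (u : 'S_n) : {measure set (plane R) -> \bar R} :=
  mscale n%:R%:nng
    (mrestr (lebesgue_measure \x lebesgue_measure)%E
            (measurable_perm_support u)).

End Permutons.

Section Demazure.
Local Open Scope nat_scope.
Variable n : nat.
Implicit Types (u v : 'S_n) (i j k l : 'I_n) (w : seq ('I_n * 'I_n)).

(* (s * t) x = t (s x) in MathComp, so that u s_i, for the usual composition
   of functions, is tperm i j * u with j = i + 1. *)
Definition tau i j u : 'S_n :=
  if u i < u j then (tperm i j * u)%g else u.

(* The unit laws only matter for n = 2: without them, the constant product equal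
   to s_1 would qualify as well. *)
Definition is_demazure (star : 'S_n -> 'S_n -> 'S_n) : Prop :=
  [/\ associative star, left_id 1%g star, right_id 1%g star &
      forall u i j, j = i.+1 :> nat -> star u (tperm i j) = tau i j u].

Let adj (p : 'I_n * 'I_n) := (p.2 == p.1.+1 :> nat).
Let run w u := foldl (fun u p => tau p.1 p.2 u) u w.
Let ltau i j u : 'S_n := (tau i j u^-1)^-1%g.
Let lrun w u := foldl (fun u p => ltau p.1 p.2 u) u w.

Let ltauE i j u :
  ltau i j u = if u^-1%g i < u^-1%g j then (u * tperm i j)%g else u.
Proof.
by rewrite /ltau /tau; case: ifP => _; rewrite ?invMg ?invgK ?tpermV.
Qed.

Let tperm_lt k l x y : l = k.+1 :> nat -> x != y ->
  ~~ ((x == k) && (y == l)) -> ~~ ((x == l) && (y == k)) ->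
  (tperm k l x < tperm k l y) = (x < y).
Proof.
move=> lk; rewrite -!(inj_eq val_inj) /=.
by case: tpermP => [->|->|/eqP+ /eqP+]; case: tpermP => [->|->|/eqP+ /eqP+];
  rewrite -?(inj_eq val_inj) /=; lia.
Qed.

Let tauC i j k l u : j = i.+1 :> nat -> l = k.+1 :> nat ->
  tau i j (ltau k l u) = ltau k l (tau i j u).
Proof.
move=> ji lk.
have ij : i != j by rewrite -(inj_eq val_inj) /= ji; lia.
have uij : u i != u j by rewrite (inj_eq perm_inj).
have kl : k != l by rewrite -(inj_eq val_inj) /= lk; lia.
have vkl : u^-1%g k != u^-1%g l by rewrite (inj_eq perm_inj).
have uV x y : (u x == y) = (u^-1%g y == x).
  by apply/eqP/eqP => <-; rewrite ?permK ?permKV.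
have [/andP[/eqP uk /eqP ul]|h1] := boolP ((u i == k) && (u j == l)).
  have kV : u^-1%g k = i by rewrite -uk permK.
  have lV : u^-1%g l = j by rewrite -ul permK.
  have tE : (u * tperm k l = tperm i j * u)%g.
    by rewrite -uk -ul -tpermJ conjgE !mulgA mulgV mul1g.
  have -> : ltau k l u = (tperm i j * u)%g by rewrite ltauE kV lV ji ltnSn tE.
  have -> : tau i j u = (tperm i j * u)%g by rewrite /tau uk ul lk ltnSn.
  rewrite ltauE /tau invMg tpermV !permM kV lV !tpermL !tpermR uk ul.
  by do 2 (rewrite ifF; last lia).
have [/andP[/eqP ul /eqP uk]|h2] := boolP ((u i == l) && (u j == k)).
  have kV : u^-1%g k = j by rewrite -uk permK.
  have lV : u^-1%g l = i by rewrite -ul permK.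
  have tu : tau i j u = u by rewrite /tau uk ul ifF //; lia.
  have lu : ltau k l u = u by rewrite ltauE kV lV ifF //; lia.
  by rewrite lu tu lu.
rewrite !ltauE /tau.
have e1 : ((u * tperm k l)%g i < (u * tperm k l)%g j) = (u i < u j).
  by rewrite !permM tperm_lt.
have e2 : ((tperm i j * u)^-1%g k < (tperm i j * u)^-1%g l)
          = (u^-1%g k < u^-1%g l).
  rewrite invMg tpermV !permM tperm_lt //.
    by rewrite -!uV.
  by rewrite -!uV andbC.
have [c|/negbTE c] := boolP (u^-1%g k < u^-1%g l);
  have [c'|/negbTE c'] := boolP (u i < u j);
  by rewrite ?e1 ?c' ?e2 ?c ?mulgA.
Qed.

Let run_tauC i j w u : j = i.+1 :> nat -> all adj w ->
  run w (ltau i j u) = ltau i j (run w u).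
Proof.
move=> ji; elim: w u => [//|[k l] w IH] u /= /andP[/eqP/= lk aw].
by rewrite tauC // IH.
Qed.

Let runC w w' u : all adj w -> all adj w' ->
  run w (lrun w' u) = lrun w' (run w u).
Proof.
move=> aw; elim: w' u => [//|[k l] w' IH] u /= /andP[/eqP/= lk aw'].
by rewrite IH // run_tauC.
Qed.

Let ge_id u : (forall i j, j = i.+1 :> nat -> u i < u j) ->
  forall i : 'I_n, i <= u i.
Proof.
move=> h [i]; elim: i => [//|i IH] lt_i /=.
have li : i < n by exact: ltnW.
apply: leq_trans (h (Ordinal li) (Ordinal lt_i) _); last by [].
by rewrite ltnS; exact: (IH li).
Qed.

Let descent u : u != 1%g ->
  exists i j, j = i.+1 :> nat /\ u j < u i.
Proof.
move=> u1; apply: contrapT => hn; move/eqP: u1; apply.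
have h i j : j = i.+1 :> nat -> u i < u j.
  move=> ji; rewrite ltnNge; apply/negP; rewrite leq_eqVlt => /orP[/eqP|] c.
    by have /perm_inj/(congr1 val) /= := val_inj c; lia.
  by apply: hn; exists i, j.
have hh (d : nat) i j : j = (i + d).+1 :> nat -> u i < u j.
  elim: d j => [|d IH] j ji; first by apply: h; rewrite ji addn0.
  have lt_n : (i + d).+1 < n by have := ltn_ord j; lia.
  by apply: ltn_trans (IH (Ordinal lt_n) erefl) (h _ _ _); rewrite ji /= addnS.
have hV i j : j = i.+1 :> nat -> u^-1%g i < u^-1%g j.
  move=> ji; rewrite ltnNge; apply/negP; rewrite leq_eqVlt => /orP[/eqP|] c.
    by have /perm_inj/(congr1 val) /= := val_inj c; lia.
  have := hh (u^-1%g i - (u^-1%g j).+1) (u^-1%g j) (u^-1%g i).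
  by rewrite !permKV ji => H; have := H ltac:(lia); lia.
apply/permP => i; rewrite perm1; apply: val_inj; apply/eqP; rewrite eqn_leq.
by have := ge_id hV (u i); rewrite permK => -> /=; exact: ge_id.
Qed.

Let meas u := \sum_(i < n) i * u i.

Let meas_le u : meas u <= n * (n * n).
Proof.
rewrite -[X in X * _]card_ord -sum_nat_const; apply: leq_sum => i _.
by apply: leq_mul; exact: ltnW.
Qed.

Let meas_lt u i j : j = i.+1 :> nat -> u j < u i ->
  meas u < meas (tperm i j * u)%g.
Proof.
move=> ji lt_u; have ij : j != i by rewrite -(inj_eq val_inj) /= ji; lia.
rewrite /meas (bigD1 i) //= (bigD1 j) //= [ltnRHS](bigD1 i) //=.
rewrite [in ltnRHS](bigD1 j) //= !permM tpermL tpermR.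
rewrite [X in _ < _ + (_ + X)](eq_bigr (fun k : 'I_n => k * u k)); last first.
  by move=> k /andP[ki kj]; rewrite permM tpermD // eq_sym.
by rewrite ji; nia.
Qed.

Let reach u : exists w, all adj w /\ run w 1%g = u.
Proof.
have [m] := ubnP (n * (n * n) - meas u); elim: m u => [//|m IH] u lem.
have [->|/descent[i [j [ji lt_u]]]] := eqVneq u 1%g; first by exists [::].
have lt_m := meas_lt ji lt_u; have le_m := meas_le (tperm i j * u)%g.
have /IH[w [aw wE]] : n * (n * n) - meas (tperm i j * u)%g < m by lia.
exists (rcons w (i, j)); split; first by rewrite all_rcons aw andbT /adj ji /=.
rewrite /run foldl_rcons -/(run w 1%g) wE /tau /= !permM tpermL tpermR lt_u.
by rewrite mulgA tperm2 mul1g.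
Qed.

Let lrunV w u : lrun w u = (run w u^-1)^-1%g.
Proof.
elim: w u => [|p w IH] u /=; first by rewrite invgK.
by rewrite IH /ltau invgK.
Qed.

Let run_eq w w' u : all adj w -> all adj w' ->
  run w 1%g = run w' 1%g -> run w u = run w' u.
Proof.
move=> aw aw' e; have [z [az zE]] := reach u^-1%g.
have <- : lrun z 1%g = u by rewrite lrunV invg1 zE invgK.
by rewrite !runC // e.
Qed.

Lemma is_demazure_exists : exists star, is_demazure star.
Proof.
have [word wordP] := choice reach.
pose star u v := run (word v) u.
have starE u w : all adj w -> star u (run w 1%g) = run w u.
  by move=> aw; have [a b] := wordP (run w 1%g); exact: run_eq.
exists star; split.
- move=> u v t; have [av vE] := wordP v; have [at_ tE] := wordP t.
  have -> : star v t = run (word v ++ word t) 1%g.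
    by rewrite /run foldl_cat -/(run (word v) 1%g) vE.
  by rewrite starE ?all_cat ?av // /run foldl_cat.
- by move=> u; have [] := wordP u.
- by move=> u; exact: (starE u [::]).
move=> u i j ji; have := starE u [:: (i, j)].
by rewrite /run /= /adj /= ji eqxx {1}/tau !perm1 ji ltnSn mulg1 => ->.
Qed.

Lemma is_demazure_uniq star star' :
  is_demazure star -> is_demazure star' -> star = star'.
Proof.
have key s : is_demazure s -> forall u w, all adj w -> s u (run w 1%g) = run w u.
  move=> [sA _ s1 sE] u; elim/last_ind => [_|w [i j] IH]; first exact: s1.
  rewrite all_rcons {1}/adj /= => /andP[/eqP ji aw].
  rewrite /run !foldl_rcons -/(run w 1%g) -/(run w u) /=.
  by rewrite -sE // sA IH // sE.
move=> h h'; apply/funext => u; apply/funext => v.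
by have [w [aw <-]] := reach v; rewrite (key _ h) // (key _ h').
Qed.

Definition demazure : 'S_n -> 'S_n -> 'S_n := sval (cid is_demazure_exists).

Lemma demazureP : is_demazure demazure.
Proof. exact: svalP (cid is_demazure_exists). Qed.

End Demazure.

(* Main.v *)
(* Height functions [H] of permutons are exactly the functions [y - C x y] with
   [C] a copula, and this class is stable under the min-plus product: comparing
   the minimizers at two opposite corners of a rectangle, the rectangle
   inequality reduces to the one for [mu] or to the one for [nu].  A permuton
   with a prescribed height function is realized as the law of a quantile
   transform: Radon-Nikodym densities of the Stieltjes measures of
   [x |-> q - H x q] serve as conditional distribution functions.

   For permutations the min-plus formula holds exactly at grid points, by
   induction on a reduced word.  Weak convergence of permutons is equivalent to
   pointwise convergence of their height functions, which are uniformly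
   Lipschitz, so the formula passes to the limit. *)
Require Import Defs.
From HB Require Import structures.
From mathcomp Require Import all_boot all_order all_algebra all_fingroup.
From mathcomp Require Import all_classical all_reals all_analysis.
From mathcomp Require Import measurable_realfun.
From mathcomp Require Import zify ring lra.

Set Implicit Arguments.
Unset Strict Implicit.
Unset Printing Implicit Defensive.

Import Order.TTheory GRing.Theory Num.Theory.
Import numFieldNormedType.Exports.

Local Open Scope classical_set_scope.
Local Open Scope ring_scope.

(** * Heights of permutations and the Demazure product *)

Section PermHeight.
Local Open Scope nat_scope.
Variable n : nat.
Implicit Types (u v : 'S_n) (i j : 'I_n) (k l : nat).

(** Three obstacles shape the proof. Radon-Nikodym densities are fixed only up to null sets, so the
    density at level [q] is below the one at [q'] only off a null set depending on both levels. The
    quantile transform therefore consults rational levels only: countably many null sets are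
    discarded together, and measurability reduces to countable unions. It gives the mass of
    quadrants that are open at the top, since an infimum is below [y] exactly when some member is;
    closed rectangles come afterwards by continuity. In the limit, the minimizer [g] for
    [demazure (u n) (v n)] moves with [n], while heights converge only pointwise. Rounding [g] to a
    fixed finite grid replaces locally uniform convergence. A height is the mass of a closed
    rectangle, whose indicator is not continuous. The Lipschitz bound makes thin strips around its
    sides light, so ramps can replace the indicator. For [n = 0] the measure [perm_permuton u] is
    zero, hence the uniform marginals of the sequences hold only eventually. *)

Lemma perm_nondecreasing_id u : (forall i, i <= u i) -> u = 1%g.
Proof.
move=> le_u; apply/permP => i; rewrite perm1; apply/val_inj/eqP.
have sumE : \sum_i u i = \sum_(i < n) i by rewrite [RHS](reindex_inj (@perm_inj _ u)).
(* Termwise inequalities between families with equal sums are equalities. *)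
have [_] : (\sum_(i < n) i <= \sum_i u i ?= iff [forall i, val i == u i]).
  by apply: leqif_sum => j _; split.
by rewrite sumE eqxx => /esym/forallP/(_ i); rewrite eq_sym.
Qed.

Lemma perm_descent u : u != 1%g -> exists i j, j = i.+1 :> nat /\ u j < u i.
Proof.
move=> u1; apply: contrapT => no_desc; move/eqP: u1; apply.
apply: perm_nondecreasing_id => -[i]; elim: i => [//|i IH] lt_i /=.
have := IH (ltnW lt_i); set i0 := Ordinal _; set i1 := Ordinal lt_i => le_i.
have [//|lt_u] := ltnP i (u i1); exfalso; apply: no_desc; exists i0, i1; split => //.
rewrite ltn_neqAle (leq_trans lt_u) // andbT.
by apply/eqP => /val_inj/perm_inj/(congr1 val) /=; lia.
Qed.

(* Undoing a descent increases [\sum_i i * u i], which is bounded. *)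
Lemma perm_ind_ascent (P : 'S_n -> Prop) : P 1%g ->
  (forall u i j, j = i.+1 :> nat -> u i < u j -> P u -> P (tperm i j * u)%g) ->
  forall u, P u.
Proof.
move=> P1 PS u; pose w u := \sum_(i < n) i * u i.
have [B w_le] : exists B, forall v, w v <= B.
  exists (\sum_(i < n) n * n) => v.
  by apply: leq_sum => i _; apply: leq_mul; exact/ltnW/ltn_ord.
have [m] := ubnP (B - w u); elim: m u => [//|m IH] u lt_m.
have [->//|/perm_descent[i [j [ji lt_u]]]] := eqVneq u 1%g.
have ij : j != i by rewrite -(inj_eq val_inj) /= ji; lia.
rewrite -[u]mul1g -(tperm2 i j) -mulgA; apply: PS => //.
  by rewrite !permM tpermL tpermR.
have w_lt : w u < w (tperm i j * u)%g.
  have wE v : w v = i * v i + (j * v j + \sum_(k < n | (k != i) && (k != j)) k * v k).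
    by rewrite /w (bigD1 i) //= (bigD1 j).
  rewrite !wE !permM tpermL tpermR.
  rewrite [X in _ < _ + (_ + X)](eq_bigr (fun k : 'I_n => k * u k)); last first.
    by move=> k /andP[ki kj]; rewrite permM tpermD // eq_sym.
  by rewrite !addnA ltn_add2r ji !mulSn; lia.
by apply: IH; exact: leq_trans (ltn_sub2l (leq_trans w_lt (w_le _)) w_lt) lt_m.
Qed.

(** The discrete height function: [perm_permuton_fheight] identifies it with [n] times the height of
    [perm_permuton u] at the grid point [(k/n, l/n)]. *)
Definition perm_height u k l := \sum_(i < n | k <= i) (u i < l).

Lemma perm_heightS u i l : perm_height u i l = (u i < l) + perm_height u i.+1 l.
Proof.
rewrite /perm_height (bigD1 i) //=; congr (_ + _); apply: eq_bigl => j.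
by rewrite ltn_neqAle andbC eq_sym.
Qed.

(** After [tau], position [j] holds the smaller of the two values, whether or not a swap occurred.
    It contributes 1 to row [j] as soon as one of them is below [l], hence the truncation by [minn];
    the other rows see both positions or neither. *)
Lemma perm_height_tau u i j k l : j = i.+1 :> nat ->
  perm_height (tau i j u) k l =
    if k == j then minn (perm_height u i l) (perm_height u j.+1 l).+1
    else perm_height u k l.
Proof.
move=> ji; have ij : i != j by rewrite -(inj_eq val_inj) /= ji; lia.
have uij : u i != u j :> nat by rewrite (inj_eq val_inj) (inj_eq perm_inj).
have hi := perm_heightS u i l; have hj := perm_heightS u j l.
rewrite -ji in hi; rewrite /tau; case: ltnP => lt_u; last first.
  by case: eqP => // ->; rewrite hi hj; lia.
have kE k' : k' != j -> perm_height (tperm i j * u)%g k' l = perm_height u k' l.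
  move=> k'j; rewrite /perm_height [RHS](reindex_inj (@perm_inj _ (tperm i j))) /=.
  apply: eq_big => [x|x _]; last by rewrite permM.
  by case: tpermP => // ->; lia.
case: eqP => [->|/eqP/kE//].
by rewrite perm_heightS kE ?permM ?tpermR; [rewrite hi hj|]; lia.
Qed.

Lemma perm_height1_diag k : perm_height 1 k k = 0.
Proof. by rewrite /perm_height big1 // => i; rewrite perm1; lia. Qed.

(** An index counted on the left is either at least [m], and counted by the first term, or in [[k,
    m[], and counted by the second. *)
Lemma perm_height_mul1 u m k l :
  perm_height u k l <= perm_height u m l + perm_height 1 k m.
Proof.
rewrite /perm_height big_mkcond [X in _ <= X + _]big_mkcond [X in _ <= _ + X]big_mkcond.
rewrite -big_split; apply: leq_sum => i _ /=; rewrite perm1.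
by case: (ltnP (u i) l); case: (leqP k i); case: (leqP m i); lia.
Qed.

(* By induction along [v]: the recurrence of [perm_height_tau] commutes with
   min-plus multiplication by [perm_height u]. *)
Lemma perm_height_demazure u v k l : k <= n ->
  (forall m, m <= n -> perm_height (demazure u v) k l <= perm_height u m l + perm_height v k m)
  /\ exists2 m, m <= n & perm_height (demazure u v) k l = perm_height u m l + perm_height v k m.
Proof.
have [starA _ star1 starS] := demazureP n.
elim/perm_ind_ascent: v k => [|v i j ji lt_v IH] k kn.
  rewrite star1; split=> [m _|]; first exact: perm_height_mul1.
  by exists k => //; rewrite perm_height1_diag addn0.
have -> : (tperm i j * v)%g = tau i j v by rewrite /tau lt_v.
have -> : demazure u (tau i j v) = tau i j (demazure u v) by rewrite -!starS.
rewrite perm_height_tau //; case: eqP => kj; last first.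
  have [le_min [m mn minE]] := IH k kn.
  by split=> [m' m'n|]; [|exists m => //]; rewrite perm_height_tau // ifN ?le_min //; apply/eqP.
have [le_i [mi min miE]] := IH i (ltnW (ltn_ord i)).
have [le_j [mj mjn mjE]] := IH j.+1 (ltn_ord j).
split=> [m mn|].
  by rewrite perm_height_tau // kj eqxx; have := le_i m mn; have := le_j m mn; lia.
have [c|c] := leqP (perm_height (demazure u v) i l) (perm_height (demazure u v) j.+1 l).+1.
  exists mi => //; rewrite perm_height_tau // kj eqxx.
  by have := le_j mi min; lia.
exists mj => //; rewrite perm_height_tau // kj eqxx.
by have := le_i mj mjn; lia.
Qed.

End PermHeight.

(** * Min-plus products of height functions *)

Section HeightFunctions.
Variable R : realType.
Implicit Types (H K M : R -> R -> R).

(* The height functions of permutons, i.e. [(x, y) |-> y - C x y] with [C] a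
   copula. *)
Definition is_height_fun H : Prop :=
  [/\ forall y : R, 0 <= y <= 1 -> H 0 y = y,
      forall y : R, 0 <= y <= 1 -> H 1 y = 0,
      forall x : R, 0 <= x <= 1 -> H x 0 = 0,
      forall x : R, 0 <= x <= 1 -> H x 1 = 1 - x &
      forall x x' y y' : R, 0 <= x -> x <= x' -> x' <= 1 -> 0 <= y -> y <= y' -> y' <= 1 ->
        H x y + H x' y' <= H x y' + H x' y].

(** An increment in one variable is bounded by the rectangle inequality on the two strips joining
    its segment to opposite sides of the square: one strip gives its sign, the other its size. *)
Lemma height_fun_dist H x x' y y' : is_height_fun H ->
  0 <= x <= 1 -> 0 <= x' <= 1 -> 0 <= y <= 1 -> 0 <= y' <= 1 ->
  `|H x y - H x' y'| <= `|x - x'| + `|y - y'|.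
Proof.
move=> [H0 H1 Hx0 Hx1 Hmono] /andP[x0 x1] /andP[x'0 x'1] /andP[y0 y1] /andP[y'0 y'1].
have distx a b z : 0 <= a -> a <= b -> b <= 1 -> 0 <= z -> z <= 1 ->
    0 <= H a z - H b z <= b - a.
  move=> a0 ab b1 z0 z1; have := Hmono a b 0 z a0 ab b1 (lexx _) z0 z1.
  have := Hmono a b z 1 a0 ab b1 z0 z1 (lexx _).
  by rewrite !Hx0 ?Hx1; lra.
have disty z a b : 0 <= a -> a <= b -> b <= 1 -> 0 <= z -> z <= 1 ->
    0 <= H z b - H z a <= b - a.
  move=> a0 ab b1 z0 z1; have := Hmono z 1 a b z0 z1 (lexx _) a0 ab b1.
  have := Hmono 0 z a b (lexx _) z0 z1 a0 ab b1.
  by rewrite ?H0 ?H1; lra.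
have -> : H x y - H x' y' = (H x y - H x' y) + (H x' y - H x' y') by ring.
apply: le_trans (ler_normD _ _) _; apply: lerD.
  have [le_x|/ltW le_x] := leP x x'.
    by have /andP[h0 h1] := distx _ _ y x0 le_x x'1 y0 y1; rewrite ger0_norm // ler0_norm; lra.
  by have /andP[h0 h1] := distx _ _ y x'0 le_x x1 y0 y1; rewrite ler0_norm ?ger0_norm; lra.
have [le_y|/ltW le_y] := leP y y'.
  by have /andP[h0 h1] := disty x' _ _ y0 le_y y'1 x'0 x'1; rewrite !ler0_norm; lra.
by have /andP[h0 h1] := disty x' _ _ y'0 le_y y1 x'0 x'1; rewrite !ger0_norm; lra.
Qed.

Definition is_minplus H K M : Prop := forall x y : R, 0 <= x <= 1 -> 0 <= y <= 1 ->
  is_min [set H g y + K x g | g in `[0, 1]] (M x y).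

Lemma within_continuous_lipschitz (f : R -> R) (k : R) (A : set R) :
  (forall a b, A a -> A b -> `|f a - f b| <= k * `|a - b|) ->
  {within A, continuous f}.
Proof.
move=> lip; apply/subspace_continuousP => a Aa.
(* [k] may be zero or negative; [|k| + 1] is a positive Lipschitz constant by which one can
   divide. *)
apply/cvgrPdist_lt => /= e e0; have k0 : 0 < `|k| + 1 by rewrite ltr_wpDl.
near=> b; have Ab : A b by near: b; exact: withinT.
apply: le_lt_trans (lip _ _ Aa Ab) _.
apply: (@le_lt_trans _ _ ((`|k| + 1) * `|a - b|)).
  by rewrite ler_wpM2r // (le_trans (ler_norm k)) // lerDl.
rewrite mulrC -ltr_pdivlMr //; near: b.
by apply: cvg_within; apply: nbhsx_ballx; rewrite divr_gt0.
Unshelve. all: end_near. Qed.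

Lemma minplus_exists H K : is_height_fun H -> is_height_fun K ->
  exists M, is_minplus H K M.
Proof.
move=> hH hK.
have ex (p : R * R) : exists m, 0 <= p.1 <= 1 -> 0 <= p.2 <= 1 ->
    is_min [set H g p.2 + K p.1 g | g in `[0, 1]] m.
  have [px|px] := boolP (0 <= p.1 <= 1); last by exists 0.
  have [py|py] := boolP (0 <= p.2 <= 1); last by exists 0.
  have [|g] := @EVT_min R (fun g => H g p.2 + K p.1 g) 0 1 ler01.
    (* The constant 2 adds the Lipschitz constants of [H] in its first and of [K] in its second
       variable. *)
    apply: (@within_continuous_lipschitz _ 2) => a b /= a01 b01.
    rewrite !in_itv /= in a01 b01.
    have -> : H a p.2 + K p.1 a - (H b p.2 + K p.1 b)
            = (H a p.2 - H b p.2) + (K p.1 a - K p.1 b) by ring.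
    apply: le_trans (ler_normD _ _) _.
    have := height_fun_dist hH a01 b01 py py.
    by have := height_fun_dist hK px px a01 b01; rewrite !subrr normr0; lra.
  move=> g01 ming; exists (H g p.2 + K p.1 g) => _ _; split; first by exists g.
  by move=> _ [g' g'01 <-]; exact: ming.
have [M MP] := choice ex; exists (fun x y => M (x, y)) => x y x01 y01.
exact: (MP (x, y)).
Qed.

Lemma minplusP H K M : is_minplus H K M -> forall x y : R, 0 <= x <= 1 -> 0 <= y <= 1 ->
  (forall g : R, 0 <= g <= 1 -> M x y <= H g y + K x g) /\
  exists2 g : R, 0 <= g <= 1 & M x y = H g y + K x g.
Proof.
move=> hM x y x01 y01; have [[g /= g01 <-] lb] := hM x y x01 y01.
split=> [g' g'01|]; last by exists g; rewrite ?in_itv in g01 *.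
by apply: lb; exists g'; rewrite //= in_itv.
Qed.

Lemma minplus_height_fun H K M : is_height_fun H -> is_height_fun K ->
  is_minplus H K M -> is_height_fun M.
Proof.
move=> hH hK /minplusP hM.
have [H0 H1 Hx0 Hx1 Hmono] := hH; have [K0 K1 Kx0 Kx1 Kmono] := hK.
have in0 : 0 <= (0 : R) <= 1 by rewrite lexx ler01.
have in1 : 0 <= (1 : R) <= 1 by rewrite lexx ler01.
have posH x y : 0 <= x <= 1 -> 0 <= y <= 1 -> 0 <= H x y.
  move=> /andP[x0 x1] /andP[y0 y1].
  have := Hmono x 1 0 y x0 x1 (lexx _) (lexx _) y0 y1.
  by rewrite !Hx0 ?H1 ?x0 ?y0 ?y1 //; lra.
have posK x y : 0 <= x <= 1 -> 0 <= y <= 1 -> 0 <= K x y.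
  move=> /andP[x0 x1] /andP[y0 y1].
  have := Kmono x 1 0 y x0 x1 (lexx _) (lexx _) y0 y1.
  by rewrite !Kx0 ?K1 ?x0 ?y0 ?y1 //; lra.
split.
- move=> y y01; have [le_M [g g01 E]] := hM 0 y in0 y01; have := le_M 0 in0.
  rewrite E H0 // !K0 // addr0; have /andP[g0 g1] := g01; have /andP[y0 y1] := y01.
  have := Hmono 0 g y 1 (lexx _) g0 g1 y0 y1 (lexx _).
  by rewrite !H0 // Hx1 //; lra.
- move=> y y01; have [le_M [g g01 E]] := hM 1 y in1 y01; have := le_M 1 in1.
  rewrite H1 // K1 // E; have := posH g y g01 y01; have := posK 1 g in1 g01; lra.
- move=> x x01; have [le_M [g g01 E]] := hM x 0 x01 in0; have := le_M 0 in0.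
  rewrite Hx0 // Kx0 // E; have := posH g 0 g01 in0; have := posK x g x01 g01; lra.
- move=> x x01; have [le_M [g g01 E]] := hM x 1 x01 in1; have := le_M 1 in1.
  rewrite E Hx1 // Hx1 // Kx1 //; have /andP[g0 g1] := g01; have /andP[x0 x1] := x01.
  have := Kmono 0 x g 1 (lexx _) x0 x1 g0 g1 (lexx _).
  by rewrite !K0 // Kx1 //; lra.
move=> x x' y y' x0 xx' x'1 y0 yy' y'1.
have x01 : 0 <= x <= 1 by rewrite x0 (le_trans xx').
have x'01 : 0 <= x' <= 1 by rewrite x'1 (le_trans x0).
have y01 : 0 <= y <= 1 by rewrite y0 (le_trans yy').
have y'01 : 0 <= y' <= 1 by rewrite y'1 (le_trans y0).
have [_ [g g01 ->]] := hM x y' x01 y'01.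
have [_ [g' g'01 ->]] := hM x' y x'01 y01.
have [le1 _] := hM x y x01 y01; have [le2 _] := hM x' y' x'01 y'01.
have /andP[g0 g1] := g01; have /andP[g'0 g'1] := g'01.
(* If [g <= g'], testing [(x, y)] with [g] and [(x', y')] with [g'] makes the [K] terms cancel and
   leaves the inequality of [H]. Otherwise the tests are exchanged, the [H] terms cancel and the
   inequality of [K] remains. *)
have [gg'|/ltW g'g] := leP g g'.
  have := Hmono g g' y y' g0 gg' g'1 y0 yy' y'1.
  by have := le1 g g01; have := le2 g' g'01; lra.
have := Kmono x x' g' g x0 xx' x'1 g'0 g'g g1.
by have := le1 g' g'01; have := le2 g g01; lra.
Qed.

End HeightFunctions.

(** * Existence of a permuton with a given height function *)

Section MeasurePacking.
Context d (T : measurableType d) (R : realType).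
Implicit Type m : {measure set T -> \bar R}.

(** The proof is an argument of the definition so that instance inference can recover it from the
    term; [probability_of] below follows the same pattern. *)
Definition finite_of m & fin_num_fun m : set T -> \bar R := m.

HB.instance Definition _ m (mfin : fin_num_fun m) := Measure.on (finite_of mfin).

HB.instance Definition _ m (mfin : fin_num_fun m) :=
  Measure_isFinite.Build _ _ _ (finite_of mfin) mfin.

Definition probability_of m & m setT = 1%E : set T -> \bar R := m.

HB.instance Definition _ m (m1 : m setT = 1%E) := Measure.on (probability_of m1).

HB.instance Definition _ m (m1 : m setT = 1%E) :=
  Measure_isProbability.Build _ _ _ (probability_of m1) m1.

End MeasurePacking.

Section Densities.
Local Open Scope ereal_scope.

(** Domination by the probability [L] gives both finiteness and absolute continuity. The
    Radon-Nikodym derivative is finite everywhere, so [fine] makes it real-valued without changing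
    integrals. *)
Lemma dominated_density d (T : measurableType d) (R : realType)
    (L : probability T R) (m : {measure set T -> \bar R}) :
  (forall A, measurable A -> m A <= L A) ->
  exists f : T -> R, [/\ measurable_fun setT f, forall x, (0 <= f x)%R &
    forall A, measurable A -> m A = \int[L]_(x in A) (f x)%:E].
Proof.
move=> mL; have mfin : fin_num_fun m.
  move=> A mA; rewrite ge0_fin_numE ?measure_ge0 //.
  by apply: le_lt_trans (mL A mA) _; rewrite ltey_eq fin_num_measure.
pose m' : {finite_measure set T -> \bar R} := finite_of mfin.
have m'L : m' `<< L.
  apply/null_content_dominatesP => A mA LA0; apply/eqP.
  by rewrite eq_le measure_ge0 andbT -LA0 mL.
have [g [g0 gfin intg gE]] := radon_nikodym_sigma_finite m'L.
exists (fine \o g); split.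
- apply/measurable_EFinP.
  have -> : EFin \o (fine \o g) = g by apply/funext => x; rewrite /= fineK.
  exact: measurable_int intg.
- by move=> x /=; rewrite fine_ge0.
move=> A mA; rewrite -[LHS]/(m' A) gE //.
by apply: eq_integral => x _; rewrite /= fineK.
Qed.

(** On the set where [g < f], the nonnegative function [f - g] has integral 0, so it vanishes almost
    everywhere there; being positive there, it forces the set to be null. Finiteness of the integral
    of [g] permits the subtraction. *)
Lemma ae_le_integral d (T : measurableType d) (R : realType)
    (L : {measure set T -> \bar R}) (f g : T -> R) :
  measurable_fun setT f -> measurable_fun setT g ->
  (forall x, 0 <= f x)%R -> (forall x, 0 <= g x)%R ->
  \int[L]_x (g x)%:E < +oo ->
  (forall A, measurable A -> \int[L]_(x in A) (f x)%:E <= \int[L]_(x in A) (g x)%:E) ->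
  {ae L, forall x, (f x <= g x)%R}.
Proof.
move=> mf mg f0 g0 gfin le_int.
pose A := [set x | (g x < f x)%R].
have mA : measurable A.
  rewrite -[A]setTI /A; under eq_set do rewrite -lte_fin.
  by apply: measurable_lte => //; exact/measurable_EFinP.
have mfA : measurable_fun A (EFin \o f).
  by apply/measurable_EFinP; exact: measurable_funS mf.
have mgA : measurable_fun A (EFin \o g).
  by apply/measurable_EFinP; exact: measurable_funS mg.
have mfgA : measurable_fun A (EFin \o (f \- g)%R).
  apply/measurable_EFinP; apply: measurable_funB; exact/measurable_EFinP.
have fgA0 x : A x -> 0 <= (EFin \o (f \- g)%R) x.
  by rewrite /A /= lee_fin subr_ge0 => /ltW.
have gAfin : \int[L]_(x in A) (g x)%:E < +oo.
  apply: le_lt_trans gfin; apply: ge0_subset_integral => //.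
    exact/measurable_EFinP.
  by move=> x _; rewrite lee_fin.
have gAge0 : 0 <= \int[L]_(x in A) (g x)%:E by apply: integral_ge0 => x _; rewrite lee_fin.
have intE : \int[L]_(x in A) (EFin \o (f \- g)%R) x + \int[L]_(x in A) (g x)%:E
          = \int[L]_(x in A) (f x)%:E.
  rewrite -ge0_integralD //; last by move=> x _; rewrite lee_fin.
  by apply: eq_integral => x _; rewrite /= -EFinD subrK.
have int0 : \int[L]_(x in A) `|(EFin \o (f \- g)%R) x| = 0.
  rewrite (eq_integral (EFin \o (f \- g)%R)); last first.
    by move=> x /set_mem Ax; rewrite gee0_abs ?fgA0.
  apply/eqP; rewrite eq_le integral_ge0 // andbT.
  rewrite -(@leeD2rE _ (\int[L]_(x in A) (g x)%:E)) ?ge0_fin_numE //.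
  by rewrite intE add0e le_int.
have /(ae_eq_integral_abs _ mA mfgA) := int0.
apply: filterS => x /= fg0; rewrite leNgt; apply/negP => lt_gf.
have := fg0 lt_gf; case => /eqP; rewrite subr_eq0 => /eqP E.
by rewrite E ltxx in lt_gf.
Qed.

End Densities.

Section Stieltjes.
Variable R : realType.
Local Notation T := (measurableTypeR R).

Lemma stieltjes_exists (f : R -> R) : {homo f : x y / x <= y} -> continuous f ->
  exists m : {measure set T -> \bar R},
    forall a b, a <= b -> m `]a, b]%classic = (f b - f a)%:E.
Proof.
move=> nd cf; have rc : right_continuous f by exact: right_continuousW.
pose F : cumulative R R := HB.pack f (isCumulative.Build R _ R f nd rc).
exists (lebesgue_stieltjes_measure F) => a b ab.
rewrite /= /lebesgue_stieltjes_measure /measure_extension measurable_mu_extE /=.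
  by rewrite wlength_itv_bnd.
exact: is_ocitv.
Qed.

Lemma stieltjes_unique (f : R -> R) (m1 m2 : {measure set T -> \bar R}) :
  (forall a b, a <= b -> m1 `]a, b]%classic = (f b - f a)%:E) ->
  (forall a b, a <= b -> m2 `]a, b]%classic = (f b - f a)%:E) ->
  forall A, measurable A -> m1 A = m2 A.
Proof.
move=> m1E m2E A mA.
apply: (@measure_unique _ R T (@ocitv R) (fun n : nat => `](- n%:R), n%:R]%classic)) => //.
- exact: ocitvI.
- by move=> n; exact: is_ocitv.
- by rewrite bigcup_itvT.
- move=> X /ocitvP[->|[[a b] /= ab ->]]; first by rewrite !measure0.
  by rewrite m1E ?m2E // ltW.
by move=> n; rewrite /= m1E ?ltry // ge0_cp.
Qed.

End Stieltjes.

Section Slices.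
Variable R : realType.
Local Notation T := (measurableTypeR R).
Implicit Type H : R -> R -> R.

(** Retraction onto [[0, 1]]. Stieltjes measures need a nondecreasing continuous function on the
    whole line, whereas [H] is controlled only on the square. *)
Let clamp (x : R) : R := if x < 0 then 0 else if 1 < x then 1 else x.

Let clamp01 x : 0 <= clamp x <= 1.
Proof. by rewrite /clamp; case: ltP => ?; [|case: ltP => ?]; lra. Qed.

Let clamp_id x : 0 <= x <= 1 -> clamp x = x.
Proof. by move=> x01; rewrite /clamp; case: ltP => ?; [|case: ltP => ?]; lra. Qed.

Let clamp_nd_dist x y : x <= y -> 0 <= clamp y - clamp x <= y - x.
Proof.
rewrite /clamp; case: (ltP x 0) => ?; case: (ltP y 0) => ?; case: (ltP 1 x) => ?;
  by case: (ltP 1 y) => ? ?; lra.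
Qed.

Let clamp_nd : {homo clamp : x y / x <= y}.
Proof. by move=> x y /clamp_nd_dist/andP[]; rewrite subr_ge0. Qed.

Let clamp_dist x y : `|clamp x - clamp y| <= `|x - y|.
Proof.
wlog xy : x y / x <= y.
  by move=> h; have [/h//|/ltW/h] := leP x y; rewrite distrC [leRHS]distrC.
have /andP[h0 h1] := clamp_nd_dist xy.
by rewrite distrC [leRHS]distrC !ger0_norm // subr_ge0.
Qed.

(** [m q] is the first marginal of the part of the future permuton lying in the strip of ordinates
    at most [q]. *)
Lemma height_fun_slices H : is_height_fun H ->
  exists m : R -> {measure set T -> \bar R},
  [/\ forall q x : R, 0 <= q <= 1 -> 0 <= x <= 1 ->
        m q `]-oo, x]%classic = (q - H x q)%:E,
      forall q : R, 0 <= q <= 1 -> m q setT = q%:E &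
      forall (q q' : R) A, 0 <= q -> q <= q' -> q' <= 1 -> measurable A ->
        (m q A <= m q' A)%E].
Proof.
move=> hH; have [H0 H1 Hx0 Hx1 Hmono] := hH.
pose G q x := q - H (clamp x) q.
have G_cont q : 0 <= q <= 1 -> continuous (G q).
  move=> q01 x; apply/cvgrPdist_lt => e e0; near=> y.
  have -> : G q x - G q y = - (H (clamp x) q - H (clamp y) q) by rewrite /G; ring.
  rewrite normrN; apply: (@le_lt_trans _ _ `|x - y|); last first.
    by near: y; exact: (nbhsx_ballx x e e0).
  apply: le_trans (clamp_dist _ _).
  have := @height_fun_dist _ H _ _ q q hH (clamp01 x) (clamp01 y) q01 q01.
  by rewrite subrr normr0 addr0.
have G_diff q q' x y : 0 <= q -> q <= q' -> q' <= 1 -> x <= y ->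
    G q y - G q x <= G q' y - G q' x.
  move=> q0 qq' q'1 xy; have /andP[x0 _] := clamp01 x; have /andP[_ y1] := clamp01 y.
  by have := Hmono _ _ q q' x0 (clamp_nd xy) y1 q0 qq' q'1; rewrite /G; lra.
have G_nd q : 0 <= q <= 1 -> {homo G q : x y / x <= y}.
  move=> /andP[q0 q1] x y xy; have := G_diff 0 q x y (lexx _) q0 q1 xy.
  by rewrite /G !Hx0 //; lra.
have ex q : exists s : {measure set T -> \bar R}, 0 <= q <= 1 ->
    forall a b, a <= b -> s `]a, b]%classic = (G q b - G q a)%:E.
  have [q01|q01] := boolP (0 <= q <= 1); last by exists mzero.
  by have [s sE] := stieltjes_exists (G_nd _ q01) (G_cont _ q01); exists s.
have [s sE] := choice ex.
(* Restricting to []0, 1]], outside of which [G q] is constant, turns a ray into a bounded interval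
   whose mass is given by [sE]. *)
have m01 : measurable (`]0, 1]%classic : set T) by exact: measurable_itv.
exists (fun q => mrestr (s q) m01); split.
- move=> q x q01 x01; have /andP[x0 x1] := x01; rewrite /= /mrestr.
  have -> : `]-oo, x] `&` `]0, 1] = `]0, x]%classic.
    apply/seteqP; split=> z /=; rewrite !in_itv /=; first by case=> -> /andP[->].
    by move=> /andP[-> zx]; rewrite zx (le_trans zx).
  rewrite sE // /G !clamp_id ?lexx ?ler01 // H0 //; congr (_%:E); ring.
- move=> q q01; rewrite /= /mrestr setTI sE ?ler01 // /G !clamp_id ?lexx ?ler01 //.
  by rewrite H0 // H1 //; congr (_%:E); ring.
move=> q q' A q0 qq' q'1 mA.
have q01 : 0 <= q <= 1 by rewrite q0 (le_trans qq').
have q'01 : 0 <= q' <= 1 by rewrite q'1 (le_trans q0).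
(* The rectangle inequality makes [G q' - G q] nondecreasing. Its Stieltjes measure [k] satisfies
   [s q' = s q + k] by uniqueness, whence the monotonicity in [q]. *)
have [k kE] : exists k : {measure set T -> \bar R}, forall a b, a <= b ->
    k `]a, b]%classic = ((G q' b - G q b) - (G q' a - G q a))%:E.
  apply: (stieltjes_exists (f := fun x => G q' x - G q x)).
    by move=> x y xy /=; have := G_diff q q' x y q0 qq' q'1 xy; lra.
  by move=> x; apply: cvgB; exact: G_cont.
rewrite /= /mrestr.
have mA01 : measurable (A `&` `]0, 1] : set T) by exact: measurableI.
rewrite [leRHS](@stieltjes_unique _ (G q') _ (measure_add (s q) k)) //.
- by rewrite [leRHS]measure_addE leeDl.
- exact: sE.
move=> a b ab; rewrite [LHS]measure_addE.
by rewrite sE // kE //; rewrite -EFinD; congr (_%:E); ring.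
Unshelve. all: end_near. Qed.

End Slices.

Section CopulaProbability.
Variable R : realType.
Local Notation T := (measurableTypeR R).

(** [f q s] plays the conditional probability that the second coordinate is at most [q] when the
    first is [s]. The reference measure [L] is the slice at level 1, which dominates all others and
    is uniform because [H x 1 = 1 - x]. *)
Lemma height_fun_densities (H : R -> R -> R) : is_height_fun H ->
  exists (L : probability T R) (f : R -> T -> R),
  [/\ forall x : R, 0 <= x <= 1 -> L `]-oo, x]%classic = x%:E,
      forall q : R, 0 <= q <= 1 -> measurable_fun setT (f q) /\ (forall s, 0 <= f q s),
      forall q : R, 0 <= q <= 1 -> {ae L, forall s, f q s <= 1},
      forall q q' : R, 0 <= q -> q <= q' -> q' <= 1 -> {ae L, forall s, f q s <= f q' s} &
      forall q x : R, 0 <= q <= 1 -> 0 <= x <= 1 ->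
        (\int[L]_(s in `]-oo, x]) (f q s)%:E)%E = (q - H x q)%:E].
Proof.
move=> hH; have [m [mE mT mle]] := height_fun_slices hH.
have in01 : 0 <= (1 : R) <= 1 by rewrite ler01 lexx.
pose L : probability T R := probability_of (mT 1 in01).
have ex q : exists f : T -> R, 0 <= q <= 1 ->
    [/\ measurable_fun setT f, forall s, 0 <= f s &
      forall A, measurable A -> m q A = (\int[L]_(s in A) (f s)%:E)%E].
  have [q01|q01] := boolP (0 <= q <= 1); last by exists (cst 0).
  have [|f fP] := @dominated_density _ T R L (m q); last by exists f.
  by move=> A mA; have /andP[q0 q1] := q01; exact: mle.
have [f fP] := choice ex; exists L, f; split.
- move=> x x01; rewrite -[LHS]/(m 1 _) mE //.
  by have [_ _ _ Hx1 _] := hH; rewrite Hx1 // opprB addrC subrK.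
- by move=> q q01; have [? ?] := fP q q01.
- move=> q q01; have [mf f0 fE] := fP q q01.
  apply: ae_le_integral => //.
    by rewrite integral_cst // mul1e; exact: le_lt_trans (probability_le1 L measurableT) (ltry 1).
  move=> A mA; rewrite -fE // integral_cst // mul1e.
  by have /andP[q0 q1] := q01; exact: mle.
- move=> q q' q0 qq' q'1.
  have [|mf f0 fE] := fP q; first by rewrite q0 (le_trans qq').
  have q'01 : 0 <= q' <= 1 by rewrite q'1 (le_trans q0).
  have [mf' f'0 f'E] := fP q' q'01.
  apply: ae_le_integral => //.
    by rewrite -f'E // mT // ltry.
  by move=> A mA; rewrite -fE // -f'E //; exact: mle.
move=> q x q01 x01; have [mf f0 fE] := fP q q01.
by rewrite -fE ?mE.
Qed.


End CopulaProbability.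
Section CopulaProbability.
Variable R : realType.
Local Notation T := (measurableTypeR R).

(** [inf (D f p)] is the quantile of order [p.2] of the conditional distribution function
    [q |-> f q p.1]. The point 1 keeps the set nonempty. *)
Let D (f : R -> T -> R) (p : T * T) : set R :=
  [set z | z = 1 \/ exists q : rat, [/\ z = ratr q, 0 <= z <= 1 & p.2 <= f z p.1]].

Let inf_D_lt f p y :
  inf (D f p) < y <-> 1 < y \/ exists q : rat, [/\ ratr q < y, 0 <= (ratr q : R) <= 1 & p.2 <= f (ratr q) p.1].
Proof.
have lbD : has_lbound (D f p).
  by exists 0 => z [->|[q [-> /andP[? _] _]]] //; exact: ler01.
split=> [lt_y|[y1|[q [qy q01 pf]]]].
- have [|z [->|[q [-> q01 pf]]] zy] := inf_lt _ lt_y; first by exists 1; left.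
    by left.
  by right; exists q.
- by apply: le_lt_trans y1; apply: ge_inf => //; left.
by apply: le_lt_trans qy; apply: ge_inf => //; right; exists q.
Qed.

Let measurable_hypograph (g : T -> R) : measurable_fun setT g ->
  measurable [set p : T * T | p.2 <= g p.1].
Proof.
move=> mg; rewrite -[X in measurable X]setTI.
apply: measurable_fun_le => //.
by apply: measurableT_comp mg _; exact: measurable_fst.
Qed.

Let measurable_inf_D f :
  (forall q : R, 0 <= q <= 1 -> measurable_fun setT (f q)) ->
  measurable_fun setT (fun p : T * T => inf (D f p)).
Proof.
move=> mf; apply: (measurability _ (RGenInftyO.measurableE R)) => //.
move=> _ [_ [y ->] <-]; rewrite setTI.
have -> : (fun p => inf (D f p)) @^-1` `]-oo, y[ =
    (if 1 < y then setT else set0) `|`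
    \bigcup_(q : rat) (if (ratr q < y) && (0 <= (ratr q : R) <= 1)
                       then [set p : T * T | p.2 <= f (ratr q) p.1] else set0).
  apply/seteqP; split=> p /=; rewrite in_itv /=.
    move=> /inf_D_lt[->|[q [qy q01 pf]]]; [by left|right].
    by exists q => //; rewrite qy q01.
  case=> [|[q _]]; case: ifP => [h pf|_ []]; apply/inf_D_lt; first by left.
  by move: h => /andP[qy q01]; right; exists q.
apply: measurableU; first by case: ifP.
apply: bigcupT_measurable_rat => q; case: ifP => // /andP[_ q01].
by apply: measurable_hypograph; exact: mf.
Qed.

(* The first coordinate is uniform; conditionally on it being [s], the second
   one is the quantile transform of a uniform variable for the distribution
   function [q |-> f q s], where [f q] is the density of [x |-> q - H x q]. *)
Lemma height_fun_probability (H : R -> R -> R) : is_height_fun H ->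
  exists rho : probability (plane R) R, forall x y : R,
    0 <= x <= 1 -> 0 <= y <= 1 -> rho (`]-oo, x] `*` `]-oo, y[) = (y - H x y)%:E.
Proof.
move=> hH; have [L [f [LE f_meas f_le1 f_le fE]]] := height_fun_densities hH.
have L_le (z : R) : 0 <= z -> (L `]-oo, z]%classic <= z%:E)%E.
  move=> z0; have [z1|/ltW z1] := leP z 1; first by rewrite LE ?z0.
  by apply: le_trans (probability_le1 L _) _; rewrite ?lee_fin.
have mphi : measurable_fun setT (fun p : T * T => inf (D f p)).
  by apply: measurable_inf_D => q /f_meas[].
pose X (p : T * T) : T * T := (p.1, inf (D f p)).
have mX : measurable_fun setT X.
  by apply: measurable_fun_pair => //; exact: measurable_fst.
pose X' : {mfun (T * T)%type >-> (T * T)%type} :=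
  HB.pack X (isMeasurableFun.Build _ _ _ _ _ mX).
exists (distribution (L \x L)%E X') => x y x01 y01.
have mxy : measurable (`]-oo, x] `*` `]-oo, y[ : set (T * T)).
  by apply: measurableX; exact: measurable_itv.
pose W := X @^-1` (`]-oo, x] `*` `]-oo, y[).
have mW : measurable W by rewrite -[W]setTI; exact: (mX measurableT).
have mx : measurable (`]-oo, x]%classic : set T) by exact: measurable_itv.
(* The mass is computed by sections; those over points outside []-oo, x]] are empty. *)
have WE : distribution (L \x L)%E X' (`]-oo, x] `*` `]-oo, y[) =
    (\int[L]_(s in `]-oo, x]) L (xsection W s))%E.
  rewrite integral_mkcond; apply: eq_integral => s _ /=.
  rewrite patchE; case: ifPn => // /negP sx.
  rewrite (_ : xsection _ s = set0) ?measure0 //.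
  rewrite -subset0 => t; rewrite /xsection /= inE => -[/= sx' _]; apply: sx.
  by rewrite inE.
have mLW : measurable_fun `]-oo, x] (L \o xsection W).
  by apply: measurable_funS (measurable_fun_xsection L mW).
have mEf q : 0 <= q <= 1 -> measurable_fun (`]-oo, x]%classic : set T) (EFin \o f q).
  move=> /f_meas[mf _]; apply: (@measurable_funS _ _ _ _ setT) => //.
  exact/measurable_EFinP.
have f0 q s : 0 <= q <= 1 -> 0 <= f q s by move=> /f_meas[].
have /andP[y0 y1] := y01.
apply: (etrans WE); apply/eqP; rewrite eq_le; apply/andP; split.
  (* Upper bound: for almost every [s], the inequality holds for all rational levels below [y] at
     once, so the section over [s] lies in []-oo, f y s]]. The rationals are enumerated through
     [unpickle] to intersect countably many full sets. *)
  have ae_f : {ae L, forall s, forall q : rat, 0 <= (ratr q : R) <= 1 -> ratr q < y ->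
      f (ratr q) s <= f y s}.
    suff : {ae L, forall s, forall n : nat, forall q : rat, unpickle n = Some q ->
        0 <= (ratr q : R) <= 1 -> ratr q < y -> f (ratr q) s <= f y s}.
      by apply: filterS => s h q; apply: (h (pickle q)); rewrite pickleK.
    apply: ae_foralln => n; case: (unpickle n) => [q|]; last by apply: aeW.
    have [/andP[q0 q1]|h] := boolP (0 <= (ratr q : R) <= 1); last first.
      by apply: aeW => s _ [<-] /(negP h).
    have [qy|h] := boolP ((ratr q : R) < y); last by apply: aeW => s _ [<-] _ /(negP h).
    by apply: filterS (f_le _ _ q0 (ltW qy) y1) => s le_f _ [<-].
  rewrite -fE //; apply: ae_ge0_le_integral => //.
  - by move=> s _; rewrite lee_fin f0.
  - exact: mEf.
  apply: filterS ae_f => s le_f _; apply: le_trans (L_le _ (f0 y s y01)).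
  apply: le_measure; rewrite ?inE //; first exact: measurable_xsection.
  move=> t; rewrite /xsection /= inE => -[_] /=; rewrite !in_itv /=.
  move=> /inf_D_lt[|[q [qy q01 pf]]]; first by rewrite ltNge y1.
  by apply: le_trans pf _; exact: le_f.
(* Lower bound: the section contains []-oo, f q s]], of mass [f q s] for almost every [s] because
   [f q s <= 1] there. *)
have lower (q : rat) : 0 <= (ratr q : R) -> ratr q < y ->
    ((ratr q - H x (ratr q))%:E <= \int[L]_(s in `]-oo, x]) L (xsection W s))%E.
  move=> q0 qy; have q01 : 0 <= (ratr q : R) <= 1 by rewrite q0 (le_trans (ltW qy)).
  rewrite -fE //; apply: ae_ge0_le_integral => //.
  - by move=> s _; rewrite lee_fin f0.
  - exact: mEf.
  apply: filterS (f_le1 _ q01) => s f1 sx; rewrite -LE ?f0 //.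
  apply: le_measure; rewrite ?inE //; first exact: measurable_xsection.
  move=> t; rewrite /= in_itv /= => tf; rewrite /xsection /= inE; split => //=.
  by rewrite in_itv /=; apply/inf_D_lt; right; exists q.
(* For [y = 0] there is no rational level in [[0, y[]; otherwise one is taken within [e] of [y], and
   [H] is nondecreasing in its second variable. *)
have [->|y_neq0] := eqVneq y 0.
  have [_ _ Hx0 _ _] := hH; rewrite Hx0 // subrr.
  by apply: integral_ge0 => s _; exact: measure_ge0.
have y_gt0 : 0 < y by rewrite lt_neqAle eq_sym y_neq0.
apply/lee_addgt0Pr => e e0.
have [|q] := @rat_in_itvoo R (Num.max 0 (y - e)) y.
  by rewrite gt_max y_gt0 ltrBlDr ltrDl.
rewrite in_itv /= gt_max => /andP[/andP[q0 yq] qy].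
apply: le_trans (leeD2r _ (lower q (ltW q0) qy)).
rewrite -EFinD lee_fin.
have [_ _ _ _ Hmono] := hH; have /andP[x0 x1] := x01.
have := Hmono x 1 (ratr q) y x0 x1 (lexx _) (ltW q0) (ltW qy) y1.
have [_ H1 _ _ _] := hH; rewrite !H1 // ?(ltW q0) ?(le_trans (ltW qy)) //.
by lra.
Qed.

End CopulaProbability.

Section Rectangles.
Variable R : realType.
Implicit Types (m : {measure set (plane R) -> \bar R}) (rho : probability (plane R) R).
Implicit Types (a b c : itv_bound R) (i j : interval R).

Lemma measurable_rect i j : measurable ([set` i] `*` [set` j] : set (plane R)).
Proof. by apply: measurableX; exact: measurable_itv. Qed.

Let itv_disj a b c : [set` Interval a b] `&` [set` Interval b c] = set0 :> set R.
Proof.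
rewrite -subset0 => x [] /=; rewrite !itv_boundlr => /andP[_ xb] /andP[bx _].
by have := le_trans xb bx; rewrite bnd_simp ltxx.
Qed.

Lemma measure_rect_splitl m a b c j : (a <= b)%O -> (b <= c)%O ->
  m ([set` Interval a c] `*` [set` j]) =
  (m ([set` Interval a b] `*` [set` j]) + m ([set` Interval b c] `*` [set` j]))%E.
Proof.
move=> ab bc; rewrite (itv_bndbnd_setU ab bc) -measureU; try exact: measurable_rect.
  by congr (m _); apply/seteqP; split=> z /=; tauto.
by rewrite -setXI itv_disj set0X.
Qed.

Lemma measure_rect_splitr m a b c i : (a <= b)%O -> (b <= c)%O ->
  m ([set` i] `*` [set` Interval a c]) =
  (m ([set` i] `*` [set` Interval a b]) + m ([set` i] `*` [set` Interval b c]))%E.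
Proof.
move=> ab bc; rewrite (itv_bndbnd_setU ab bc) -measureU; try exact: measurable_rect.
  by congr (m _); apply/seteqP; split=> z /=; tauto.
by rewrite -setXI itv_disj setX0.
Qed.

Lemma addeI_fin (x y : \bar R) (r s : R) : (x + y)%E = s%:E -> x = r%:E -> y = (s - r)%:E.
Proof. by move=> h xr; move: h; rewrite xr; case: y => //= t [<-]; rewrite [r + t]addrC addrK. Qed.

Lemma probability_setI_full d (U : measurableType d) (P : probability U R) (A B : set U) :
  measurable A -> measurable B -> P B = 1%E -> P A = P (A `&` B).
Proof.
move=> mA mB B1; apply/eqP; rewrite eq_le; apply/andP; split; last first.
  by apply: le_measure; rewrite ?inE //; exact: measurableI.
have mAB : measurable (A `&` B) by exact: measurableI.
have mCB : measurable (~` B) by exact: measurableC.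
apply: (@le_trans _ _ (P (A `&` B `|` ~` B))).
  apply: le_measure; rewrite ?inE //; first exact: measurableU.
  by move=> z Az; have [Bz|Bz] := pselect (B z); [left|right].
have CB0 : P (~` B) = 0%E by rewrite probability_setC // B1 subee.
by rewrite -[leRHS]adde0 -CB0; exact: measureU2.
Qed.

(* The measure with distribution function [y - H x y]; the semi-open and the
   closed rectangles have the same measure because [H] is continuous. *)
Lemma height_fun_permuton (H : R -> R -> R) : is_height_fun H ->
  exists rho : probability (plane R) R, is_permuton rho /\
    forall x y : R, 0 <= x <= 1 -> 0 <= y <= 1 -> height rho x y = (H x y)%:E.
Proof.
move=> hH; have [rho rhoE'] := height_fun_probability hH; exists rho.
pose m : {measure set (plane R) -> \bar R} := rho.
have rhoE (x y : R) : 0 <= x <= 1 -> 0 <= y <= 1 ->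
    m (`]-oo, x] `*` `]-oo, y[) = (y - H x y)%:E by exact: rhoE'.
have [H0 H1 Hx0 Hx1 _] := hH.
pose V x x' y y' : R := H x y' + H x' y - H x' y' - H x y.
have ocE x x' y y' : 0 <= x -> x <= x' -> x' <= 1 -> 0 <= y -> y <= y' -> y' <= 1 ->
    m (`]x, x'] `*` `[y, y'[) = (V x x' y y')%:E.
  move=> x0 xx' x'1 y0 yy' y'1.
  have colE z : 0 <= z -> z <= 1 ->
      m (`]x, x'] `*` `]-oo, z[) = (H x z - H x' z)%:E.
    move=> z0 z1.
    have := @measure_rect_splitl m -oo%O (BRight x) (BRight x') `]-oo, z[ isT.
    rewrite bnd_simp xx' rhoE ?z0 ?z1 ?(le_trans x0) // => /(_ isT)/esym/addeI_fin.
    move=> /(_ (z - H x z)) ->; first by congr (_%:E); ring.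
    by rewrite rhoE ?z0 ?z1 ?x0 ?(le_trans xx').
  have := @measure_rect_splitr m -oo%O (BLeft y) (BLeft y') `]x, x'] isT.
  rewrite bnd_simp yy' colE ?(le_trans y0) // => /(_ isT)/esym/addeI_fin.
  move=> /(_ (H x y - H x' y)) ->; first by congr (_%:E); rewrite /V; ring.
  by rewrite colE // (le_trans yy').
have in0 : 0 <= (0 : R) <= 1 by rewrite lexx ler01.
have in1 : 0 <= (1 : R) <= 1 by rewrite ler01 lexx.
have full : m (`]0, 1] `*` `[0, 1[) = 1%E.
  rewrite ocE ?lexx ?ler01 // /V H0 // Hx0 // H1 // H0 //; congr (_%:E); ring.
(* Each of the four corner values moves by at most [2 * e], hence the factor 8. *)
have distV x x' y y' w w' z z' e : 0 <= x <= 1 -> 0 <= x' <= 1 -> 0 <= y <= 1 -> 0 <= y' <= 1 ->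
    0 <= w <= 1 -> 0 <= w' <= 1 -> 0 <= z <= 1 -> 0 <= z' <= 1 ->
    `|x - w| <= e -> `|x' - w'| <= e -> `|y - z| <= e -> `|y' - z'| <= e ->
    V x x' y y' <= V w w' z z' + 8 * e.
  move=> x01 x'01 y01 y'01 w01 w'01 z01 z'01 xe x'e ye y'e.
  have := ler_normlW (height_fun_dist hH x01 w01 y'01 z'01).
  have := ler_normlW (height_fun_dist hH x'01 w'01 y01 z01).
  have := height_fun_dist hH x'01 w'01 y'01 z'01; rewrite distrC => /ler_normlW.
  have := height_fun_dist hH x01 w01 y01 z01; rewrite distrC => /ler_normlW.
  by rewrite /V; lra.
have ccE x x' y y' : 0 <= x -> x <= x' -> x' <= 1 -> 0 <= y -> y <= y' -> y' <= 1 ->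
    m (`[x, x'] `*` `[y, y']) = (V x x' y y')%:E.
  move=> x0 xx' x'1 y0 yy' y'1.
  apply/eqP; rewrite eq_le; apply/andP; split; last first.
    rewrite -ocE //; apply: le_measure; rewrite ?inE; try exact: measurable_rect.
    move=> z [] /=; rewrite !in_itv /= => /andP[/ltW -> ->] /andP[-> /ltW ->].
    by [].
  apply/lee_addgt0Pr => e e0.
  (* The half-open shape misses the left and top sides, so the rectangle is enlarged in these two
     directions only, by [e / 8] and within the square. Where the truncation acts, intersecting with
     the half-open square of full mass supplies the strict inequality. *)
  pose a := Num.max 0 (x - e / 8); pose b := Num.min 1 (y' + e / 8).
  have e8 : 0 < e / 8 by rewrite divr_gt0.
  have a_x : 0 <= a /\ a <= x /\ `|a - x| <= e / 8.
    rewrite /a; case: (leP 0 (x - e / 8)) => h; split; rewrite ?lexx //; split; rewrite //.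
    - by lra.
    - by rewrite ler0_norm; lra.
    - by rewrite sub0r normrN ger0_norm; lra.
  have b_y : b <= 1 /\ y' <= b /\ `|b - y'| <= e / 8.
    rewrite /b; case: (leP 1 (y' + e / 8)) => h; split; rewrite ?lexx //; try lra; split; rewrite //.
    - by rewrite ger0_norm; lra.
    - by lra.
    - by rewrite ger0_norm; lra.
  have [a0 [ax axe]] := a_x; have [b1 [yb bye]] := b_y.
  have e80 : 0 <= e / 8 by exact: ltW.
  have y'0 := le_trans y0 yy'.
  have -> : m (`[x, x'] `*` `[y, y']) = m (`[x, x'] `*` `[y, y'] `&` `]0, 1] `*` `[0, 1[).
    by apply: (probability_setI_full (P := rho) _ _ full); exact: measurable_rect.
  apply: (@le_trans _ _ (V a x' y b)%:E); last first.
    rewrite -EFinD lee_fin; have -> : e = 8 * (e / 8) by field.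
    have a01 : 0 <= a <= 1 by rewrite a0 (le_trans ax) // (le_trans xx').
    have b01 : 0 <= b <= 1 by rewrite b1 (le_trans y'0).
    have x01 : 0 <= x <= 1 by rewrite x0 (le_trans xx').
    have x'01 : 0 <= x' <= 1 by rewrite x'1 (le_trans x0).
    have y01 : 0 <= y <= 1 by rewrite y0 (le_trans yy').
    have y'01 : 0 <= y' <= 1 by rewrite y'1 y'0.
    by apply: distV; rewrite ?subrr ?normr0.
  have ax' : a <= x' by exact: le_trans xx'.
  have yb' : y <= b by exact: le_trans yb.
  rewrite -ocE //.
  apply: le_measure; rewrite ?inE; try exact: measurable_rect.
    by apply: measurableI; exact: measurable_rect.
  move=> z [[]] /=; rewrite !in_itv /= => /andP[xz zx'] /andP[yz zy'] [/andP[z0 _] /andP[_ z1]].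
  rewrite zx' yz /= andbT gt_max lt_min z0 z1 /=; split.
    by apply: lt_le_trans xz; rewrite ltrBlDr ltrDl.
  by apply: le_lt_trans zy' _; rewrite ltrDl.
split=> [a b a0 ab b1|x y /andP[x0 x1] /andP[y0 y1]].
  have a01 : 0 <= a <= 1 by rewrite a0 (le_trans ab).
  have b01 : 0 <= b <= 1 by rewrite b1 (le_trans a0).
  split; rewrite [LHS]ccE ?lexx ?ler01 // /V; congr (_%:E).
    by rewrite !H0 // !H1 //; ring.
  by rewrite !Hx0 // !Hx1 //; ring.
rewrite [LHS]ccE ?lexx // /V H1 ?Hx0 ?H1 ?x0 ?y0 ?lexx ?ler01 //; congr (_%:E); ring.
Qed.

End Rectangles.

(** * Measures with uniform marginals *)

Section UniformMarginals.
Variable R : realType.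
Implicit Types (m : {measure set (plane R) -> \bar R}) (rho : probability (plane R) R).

(** The formula of [is_permuton], on general measures: [perm_permuton u] is declared only as a
    measure. *)
Definition uniform_marginals m : Prop := forall a b : R, 0 <= a -> a <= b -> b <= 1 ->
  m (`[0, 1] `*` `[a, b]) = (b - a)%:E /\ m (`[a, b] `*` `[0, 1]) = (b - a)%:E.

Definition fheight m (x y : R) : R := fine (height m x y).

Let unif_sub m A : uniform_marginals m -> measurable A -> A `<=` unit_square ->
  m A \is a fin_num.
Proof.
move=> um mA sub; rewrite ge0_fin_numE ?measure_ge0 //.
apply: (@le_lt_trans _ _ (m unit_square)).
  by apply: le_measure; rewrite ?inE //; exact: measurable_rect.
by have [-> _] := um 0 1 (lexx _) ler01 (lexx _); rewrite ltry.
Qed.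

Lemma fheightE m (x y : R) : uniform_marginals m -> 0 <= x <= 1 -> 0 <= y <= 1 ->
  height m x y = (fheight m x y)%:E.
Proof.
move=> um /andP[x0 x1] /andP[y0 y1]; rewrite fineK // unif_sub //.
  exact: measurable_rect.
move=> z [] /=; rewrite /unit_square !in_itv /= => /andP[xz z1] /andP[z2 zy].
by split; rewrite /= in_itv /= ?z1 ?z2 ?(le_trans x0) ?(le_trans zy).
Qed.

(** This half-open shape is the one obtained from the closed rectangles of [height] by exact set
    differences, with no null set to discard. *)
Lemma measure_semi_open_rect m (x x' y y' : R) : uniform_marginals m ->
  0 <= x -> x <= x' -> x' <= 1 -> 0 <= y -> y <= y' -> y' <= 1 ->
  m (`[x, x'[ `*` `]y, y']) =
    (fheight m x y' - fheight m x' y' - fheight m x y + fheight m x' y)%:E.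
Proof.
move=> um x0 xx' x'1 y0 yy' y'1.
have rowE z : 0 <= z -> z <= 1 ->
    m (`[z, 1] `*` `]y, y']) = (fheight m z y' - fheight m z y)%:E.
  move=> z0 z1.
  have := @measure_rect_splitr _ m (BLeft 0) (BRight y) (BRight y') `[z, 1].
  rewrite !bnd_simp yy' -![m (_ `*` `[0, _])]/(height m z _) => /(_ y0 isT).
  rewrite !fheightE ?z0 ?z1 ?y0 ?y'1 ?(le_trans y0) ?(le_trans yy') //.
  by move=> /esym/addeI_fin; apply.
have := @measure_rect_splitl _ m (BLeft x) (BLeft x') (BRight 1) `]y, y'].
rewrite !bnd_simp rowE ?(le_trans xx') // => /(_ isT x'1).
rewrite rowE ?(le_trans x0) // addeC => /esym/addeI_fin -/(_ _ erefl) ->.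
by congr (_%:E); ring.
Qed.

Lemma fheight_is_height_fun m : uniform_marginals m -> is_height_fun (fheight m).
Proof.
move=> um; have m0 A B : measurable A -> measurable B -> A `<=` B -> m B = 0%E -> m A = 0%E.
  move=> mA mB AB B0; apply/eqP; rewrite eq_le measure_ge0 andbT -B0.
  by apply: le_measure; rewrite ?inE.
split.
- move=> y /andP[y0 y1]; rewrite /fheight /height.
  by have [-> _] := um 0 y (lexx _) y0 y1; rewrite /= subr0.
- move=> y /andP[y0 y1]; rewrite /fheight /height.
  have [_] := um 1 1 ler01 (lexx _) (lexx _); rewrite subrr => /(m0 (`[1, 1] `*` `[0, y])) -> //;
    try exact: measurable_rect.
  by move=> z [] /= ?; rewrite !in_itv /= => /andP[-> /le_trans ->].
- move=> x /andP[x0 x1]; rewrite /fheight /height.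
  have [+ _] := um 0 0 (lexx _) (lexx _) ler01; rewrite subrr => /(m0 (`[x, 1] `*` `[0, 0])) -> //;
    try exact: measurable_rect.
  by move=> z [] /=; rewrite !in_itv /= => /andP[/(le_trans x0) -> ->].
- move=> x /andP[x0 x1]; rewrite /fheight /height.
  by have [_ ->] := um x 1 x0 x1 (lexx _).
move=> x x' y y' x0 xx' x'1 y0 yy' y'1.
have : (0 <= m (`[x, x'[ `*` `]y, y']))%E by exact: measure_ge0.
by rewrite measure_semi_open_rect // lee_fin; lra.
Qed.

Let quadrants : set (set (plane R)) :=
  [set A | exists x y : R, A = `[x, +oo[ `*` `]-oo, y]].

(** Half-planes are countable unions of quadrants, or complements of such unions, so both
    projections are measurable for the generated sigma-algebra. *)
Let measurable_quadrants : measurable = <<s quadrants >>.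
Proof.
pose U : measurableType _ := g_sigma_algebraType quadrants.
have quad (x y : R) : @measurable _ U (`[x, +oo[ `*` `]-oo, y]).
  by apply: sub_sigma_algebra; exists x, y.
have m1 : measurable_fun setT (fst : U -> measurableTypeR R).
  apply: (measurability _ (RGenCInfty.measurableE R)) => _ [_ [x ->] <-].
  rewrite setTI (_ : _ @^-1` _ = \bigcup_(n : nat) (`[x, +oo[ `*` `]-oo, n%:R])).
    by apply: bigcupT_measurable => n; exact: quad.
  apply/seteqP; split=> [z zx|z [n _ []] //].
  exists (Num.bound `|z.2|) => //; split=> //=; rewrite in_itv /=.
  by rewrite ltW // (le_lt_trans (ler_norm _)) // archi_boundP.
have m2 : measurable_fun setT (snd : U -> measurableTypeR R).
  apply: (measurability _ (RGenOInfty.measurableE R)) => _ [_ [y ->] <-].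
  rewrite setTI.
  rewrite (_ : _ @^-1` _ = ~` \bigcup_(n : nat) (`[- n%:R, +oo[ `*` `]-oo, y])).
    by apply: measurableC; apply: bigcupT_measurable => n; exact: quad.
  rewrite -setCitvl preimage_setC; congr (~` _).
  apply/seteqP; split=> [z zx|z [n _ []] //].
  exists (Num.bound `|z.1|) => //; split=> //=; rewrite in_itv /= andbT.
  by rewrite lerNl ltW // (le_lt_trans (ler_norm _)) // normrN archi_boundP.
rewrite measurable_prod_measurableType eqEsubset; split; last first.
  apply: smallest_sub; first exact: smallest_sigma_algebra.
  move=> _ [x [y ->]]; apply: sub_sigma_algebra.
  by exists `[x, +oo[%classic => //; exists `]-oo, y]%classic.
apply: smallest_sub; first exact: smallest_sigma_algebra.
move=> _ [A mA [B mB <-]].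
rewrite (_ : A `*` B = (setT `&` fst @^-1` A) `&` (setT `&` snd @^-1` B)).
  by apply: (@measurableI _ U); [exact: m1|exact: m2].
by rewrite !setTI.
Qed.

(** Quadrants form a generating class stable under intersection. As a permuton is carried by the
    square, the mass of a quadrant is a height, or 0 when the quadrant misses the square. *)
Lemma permuton_unique rho rho' : is_permuton rho -> is_permuton rho' ->
  (forall x y : R, 0 <= x <= 1 -> 0 <= y <= 1 -> height rho x y = height rho' x y) ->
  forall A, measurable A -> rho A = rho' A.
Proof.
move=> prho prho' eq_h.
have fullE P (x y : R) : is_permuton P ->
    P (`[x, +oo[ `*` `]-oo, y]) = P (`[Num.max x 0, 1] `*` `[0, Num.min y 1]).
  move=> pP; have [full _] := pP 0 1 (lexx _) ler01 (lexx _); rewrite subr0 in full.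
  rewrite (probability_setI_full _ _ full); try exact: measurable_rect.
  congr (P _); apply/seteqP; split=> z /=; rewrite !in_itv /= !andbT.
    move=> [[zx zy] [/andP[z0 z1] /andP[z0' z1']]].
    by rewrite ge_max le_min zx zy z0 z1 z0' z1'.
  by rewrite ge_max le_min => -[/andP[/andP[-> ->] ->] /andP[-> /andP[-> ->]]].
apply: (@measure_unique _ R _ quadrants (fun n : nat => `[- n%:R, +oo[ `*` `]-oo, n%:R])).
- exact: measurable_quadrants.
- move=> _ _ [x [y ->]] [x' [y' ->]]; exists (Num.max x x'), (Num.min y y').
  rewrite -setXI; congr (_ `*` _); apply/seteqP; split=> z /=; rewrite !in_itv /= ?andbT.
  + by case=> ? ?; rewrite ge_max; apply/andP.
  + by rewrite ge_max => /andP[].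
  + by case=> ? ?; rewrite le_min; apply/andP.
  + by rewrite le_min => /andP[].
- by move=> n; exists (- n%:R), n%:R.
- apply/seteqP; split=> // z _; exists (maxn (Num.bound `|z.1|) (Num.bound `|z.2|)) => //.
  split; rewrite /= in_itv /= ?andbT.
    rewrite lerNl; apply: ltW; apply: (@lt_le_trans _ _ (Num.bound `|z.1|)%:R).
      by rewrite (le_lt_trans (ler_norm _)) // normrN archi_boundP.
    by rewrite ler_nat leq_maxl.
  apply: ltW; apply: (@lt_le_trans _ _ (Num.bound `|z.2|)%:R).
    by rewrite (le_lt_trans (ler_norm _)) // archi_boundP.
  by rewrite ler_nat leq_maxr.
- move=> _ [x [y ->]]; rewrite [LHS]fullE // [RHS]fullE //.
  have [x1|x1] := leP x 1; last first.
    by rewrite set_itv_ge ?set0X ?measure0 // bnd_simp -ltNge lt_max x1.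
  have [y0|y0] := leP 0 y; last first.
    by rewrite [X in _ `*` X]set_itv_ge ?setX0 ?measure0 // bnd_simp -ltNge gt_min y0.
  by apply: eq_h; rewrite ?ge_max ?le_min ?le_max ?ge_min ?x1 ?y0 ?lexx ?ler01 ?orbT.
by move=> n; apply: le_lt_trans (probability_le1 _ _) (ltry 1); exact: measurable_rect.
Qed.

End UniformMarginals.

(** * Rectangle masses of permutons of permutations *)

Section FiniteUnions.
Context d (T : measurableType d) (R : realType) (m : {measure set T -> \bar R}).
Variables (I : finType) (F : I -> set T).
Hypothesis mF : forall i, measurable (F i).

Let bigcupE : \bigcup_i F i = \big[setU/set0]_i F i.
Proof.
rewrite -bigcup_seq (_ : [set` _] = setT) //.
by apply/seteqP; split=> i //= _; exact: mem_index_enum.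
Qed.

Let measurable_big s : measurable (\big[setU/set0]_(i <- s) F i).
Proof. by apply: bigsetU_measurable. Qed.

Lemma measure_bigcup_le : (m (\bigcup_i F i) <= \sum_i m (F i))%E.
Proof.
rewrite bigcupE; elim: (index_enum I) => [|i s IH]; first by rewrite !big_nil measure0.
rewrite !big_cons; apply: le_trans (leeD2l _ IH).
by apply: measureU2 => //; exact: measurable_big.
Qed.

Lemma measure_bigcup_disjoint : trivIset setT F -> (m (\bigcup_i F i) = \sum_i m (F i))%E.
Proof.
move=> triv; rewrite bigcupE.
elim: (index_enum I) (index_enum_uniq I) => [|i s IH] /=; first by rewrite !big_nil measure0.
move=> /andP[is_ /IH E]; rewrite !big_cons -E measureU //.
rewrite -subset0 -bigcup_seq => x [Fi [j /= js Fj]].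
have ij : i = j by apply: triv => //; exists x.
by rewrite ij js in is_.
Qed.

End FiniteUnions.

Section PermPermuton.
Variable R : realType.
Local Notation T := (measurableTypeR R).
Local Notation lam := (@lebesgue_measure R).
Variable n : nat.
Hypothesis n_gt0 : (0 < n)%N.

Let nR : 0 < n%:R :> R. Proof. by rewrite ltr0n. Qed.

(** Half-open versions of the sides of [perm_square]: they are disjoint and differ from the closed
    sides by null sets. *)
Let cell (t : nat) : set T := `[t%:R / n%:R, t.+1%:R / n%:R[.

Let mcell t : measurable (cell t). Proof. exact: measurable_itv. Qed.

Let divn_lt (s t : nat) : (s%:R / n%:R < t%:R / n%:R :> R) = (s < t)%N.
Proof. by rewrite ltr_pM2r ?invr_gt0 // ltr_nat. Qed.

Let divn_le (s t : nat) : (s%:R / n%:R <= t%:R / n%:R :> R) = (s <= t)%N.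
Proof. by rewrite ler_pM2r ?invr_gt0 // ler_nat. Qed.

Let cell_disj s t x : cell s x -> cell t x -> s = t.
Proof.
rewrite /cell /= !in_itv /= => /andP[sx xs] /andP[tx xt].
have := le_lt_trans sx xt; have := le_lt_trans tx xs.
by rewrite !divn_lt !ltnS => ts st; apply/eqP; rewrite eqn_leq st.
Qed.

Let lam_cell t : lam (cell t) = (n%:R^-1)%:E.
Proof.
rewrite lebesgue_measure_itv /= lte_fin divn_lt ltnSn -EFinB -mulrBl -natrB //.
by rewrite subSnn mul1r.
Qed.

Let lam_itv_co (J : set T) (p q : R) : measurable J ->
  lam (J `&` `[p, q]) = lam (J `&` `[p, q[).
Proof.
move=> mJ; apply/eqP; rewrite eq_le; apply/andP; split; last first.
  apply: le_measure; rewrite ?inE; try (by apply: measurableI => //; exact: measurable_itv).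
  by apply: setIS => x /=; rewrite !in_itv /= => /andP[-> /ltW].
rewrite -[leRHS]adde0 -(lebesgue_measure_set1 q).
have mco : measurable (J `&` `[p, q[) by apply: measurableI => //; exact: measurable_itv.
apply: le_trans (measureU2 _ mco (measurable_set1 q)).
apply: le_measure; rewrite ?inE; first by apply: measurableI => //; exact: measurable_itv.
  by apply: measurableU.
move=> x [Jx] /=; rewrite !in_itv /= => /andP[px]; rewrite le_eqVlt => /orP[/eqP->|xq]; first by right.
by left; split=> //; apply/andP.
Qed.

Let lam_itv_cells a b : 0 <= a -> a <= b -> b <= 1 ->
  (\sum_(i < n) lam (`[a, b] `&` cell i) = (b - a)%:E)%E.
Proof.
move=> a0 ab b1.
have -> : (\sum_(i < n) lam (`[a, b] `&` cell i) = lam (`[a, b] `&` `[0%R, 1%R[))%E.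
  rewrite -measure_bigcup_disjoint //; first last.
  - by move=> i j _ _ [x [[_ ci] [_ cj]]]; apply: val_inj; exact: cell_disj ci cj.
  - by move=> i; apply: measurableI => //; exact: measurable_itv.
  rewrite -setI_bigcupr; congr (lam (_ `&` _)); apply/seteqP; split=> x /=.
    move=> [i _]; rewrite /cell /= !in_itv /= => /andP[ix xi].
    rewrite (le_trans _ ix) ?divr_ge0 //= (lt_le_trans xi) //.
    by rewrite ler_pdivrMr // mul1r ler_nat.
  rewrite in_itv /= => /andP[x0 x1].
  have nx0 : 0 <= x * n%:R by rewrite mulr_ge0.
  have /andP[tx xt] := truncn_itv nx0.
  have tn : (Num.truncn (x * n%:R) < n)%N.
    by rewrite -(ltr_nat R) (le_lt_trans tx) // gtr_pMl.
  exists (Ordinal tn) => //; rewrite /cell /= in_itv /=.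
  by rewrite ler_pdivrMr // tx ltr_pdivlMr.
rewrite -lam_itv_co; last exact: measurable_itv.
rewrite setIidl; last first.
  by move=> x /=; rewrite !in_itv /= => /andP[ax xb]; rewrite (le_trans a0) // (le_trans xb).
rewrite lebesgue_measure_itv /= lte_fin; case: ltP => [|ba]; first by rewrite EFinB.
have -> : b = a by apply/le_anti; rewrite ab ba.
by rewrite subrr.
Qed.

(** The closed squares may share boundary points. Subadditivity over them bounds the mass above, the
    disjoint half-open cells inside them bound it below, and both sums agree because endpoints are
    null. *)
Let lam2_support (u : 'S_n) (I J : set T) : measurable I -> measurable J ->
  (lam \x lam)%E ((I `*` J) `&` perm_support u) =
  (\sum_(i < n) lam (I `&` cell i) * lam (J `&` cell (u i)))%E.
Proof.
move=> mI mJ; have mIJ : measurable (I `*` J) by exact: measurableX.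
rewrite /perm_support setI_bigcupr.
pose G (i : 'I_n) : set (T * T) := (I `*` J) `&` (cell i `*` cell (u i)).
have mG i : measurable (G i).
  by apply: measurableI => //; apply: measurableX; exact: mcell.
have msq i : measurable ((I `*` J) `&` perm_square u i : set (T * T)).
  by apply: measurableI => //; apply: measurableX; exact: measurable_itv.
have GE i : ((lam \x lam) (G i) = lam (I `&` cell i) * lam (J `&` cell (u i)))%E.
  by rewrite /G -setXI product_measure1E //; apply: measurableI => //; exact: mcell.
have sqE i : ((lam \x lam) ((I `*` J) `&` perm_square u i) = (lam \x lam) (G i))%E.
  rewrite GE /perm_square -setXI product_measure1E; first by congr (_ * _)%E; exact: lam_itv_co.
    by apply: measurableI => //; exact: measurable_itv.
  by apply: measurableI => //; exact: measurable_itv.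
apply/eqP; rewrite eq_le; apply/andP; split.
  apply: le_trans (measure_bigcup_le _ msq) _.
  by apply: lee_sum => i _; rewrite [leLHS]sqE GE.
under eq_bigr do rewrite -GE.
rewrite -(measure_bigcup_disjoint (lam \x lam)%E mG); last first.
  by move=> i j _ _ [x [[_ [ci _]] [_ [cj _]]]]; apply: val_inj; exact: cell_disj ci cj.
apply: le_measure; rewrite ?inE; try exact: fin_bigcup_measurable.
apply: subset_bigcup => i _ z [IJz [c1 c2]]; split=> //.
move: c1 c2; rewrite /cell /= !in_itv /= => /andP[h1 /ltW h2] /andP[h3 /ltW h4].
by split; rewrite /= in_itv /= ?h1 ?h3.
Qed.

Lemma perm_permutonE (u : 'S_n) (I J : set T) : measurable I -> measurable J ->
  perm_permuton u (I `*` J) =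
  (n%:R%:E * \sum_(i < n) lam (I `&` cell i) * lam (J `&` cell (u i)))%E.
Proof. by move=> mI mJ; rewrite -lam2_support. Qed.

Let lam01_cell (t : 'I_n) : lam (`[0, 1] `&` cell t) = (n%:R^-1)%:E.
Proof.
rewrite setIidr ?lam_cell // => x; rewrite /cell /= !in_itv /= => /andP[tx xt].
rewrite (le_trans _ tx) ?divr_ge0 //= (le_trans (ltW xt)) //.
by rewrite ler_pdivrMr // mul1r ler_nat.
Qed.

Lemma perm_permuton_uniform (u : 'S_n) : uniform_marginals (perm_permuton (R := R) u).
Proof.
move=> a b a0 ab b1.
split; rewrite [LHS]perm_permutonE; try exact: measurable_itv.
  under eq_bigr do rewrite lam01_cell.
  rewrite -ge0_sume_distrr; last by move=> i _; exact: measure_ge0.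
  rewrite muleA -EFinM mulfV ?gt_eqF // mul1e -(lam_itv_cells a0 ab b1).
  by rewrite [RHS](reindex_inj (@perm_inj _ u)).
under eq_bigr do rewrite lam01_cell muleC.
rewrite -ge0_sume_distrr; last by move=> i _; exact: measure_ge0.
by rewrite muleA -EFinM mulfV ?gt_eqF // mul1e -(lam_itv_cells a0 ab b1).
Qed.

(** Up to null sets, a rectangle with grid corners contains each square entirely or misses it, and
    each square has mass [n * (1/n) * (1/n) = 1/n]. *)
Lemma perm_permuton_fheight (u : 'S_n) (k l : nat) : (k <= n)%N -> (l <= n)%N ->
  fheight (perm_permuton u) (k%:R / n%:R) (l%:R / n%:R) = (perm_height u k l)%:R / n%:R :> R.
Proof.
move=> kn ln; rewrite /fheight /height [X in fine X]perm_permutonE; try exact: measurable_itv.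
have colE (i : 'I_n) : lam (`[k%:R / n%:R, 1] `&` cell i) = ((k <= i)%:R / n%:R)%:E.
  case: leqP => ki.
    rewrite setIidr ?lam_cell ?mul1r // => x; rewrite /cell /= !in_itv /= => /andP[ix xi].
    rewrite (le_trans _ ix) ?divn_le //= (le_trans (ltW xi)) //.
    by rewrite ler_pdivrMr // mul1r ler_nat.
  rewrite (_ : _ `&` _ = set0) ?measure0 ?mul0r // -subset0 => x [] /=.
  rewrite /cell /= !in_itv /= => /andP[kx _] /andP[_ xi].
  by have := le_lt_trans kx xi; rewrite divn_lt ltnS leqNgt ki.
have rowE (i : 'I_n) : lam (`[0, l%:R / n%:R] `&` cell i) = ((i < l)%:R / n%:R)%:E.
  case: ltnP => il.
    rewrite setIidr ?lam_cell ?mul1r // => x; rewrite /cell /= !in_itv /= => /andP[ix xi].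
    rewrite (le_trans _ ix) ?divr_ge0 //= (le_trans (ltW xi)) //.
    by rewrite divn_le.
  (* The closed interval [[0, l/n]] still meets the cell of index [l], in the null point [l/n]. *)
  rewrite mul0r; apply: (@subset_measure0 _ _ _ lam _ [set l%:R / n%:R]) => //.
  - by apply: measurableI => //; exact: measurable_itv.
  - move=> x [] /=; rewrite /cell /= !in_itv /= => /andP[_ xl] /andP[ix _].
    by apply/le_anti; rewrite xl (le_trans _ ix) // divn_le.
  exact: lebesgue_measure_set1.
under eq_bigr => i _ do rewrite colE rowE -EFinM.
rewrite sumEFin -EFinM /=.
rewrite /perm_height natr_sum mulr_suml [in RHS]big_mkcond mulr_sumr.
apply: eq_bigr => i _; case: (k <= i)%N; rewrite ?mul0r ?mulr0 //.
by rewrite mul1r; field; rewrite gt_eqF.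
Qed.

End PermPermuton.

(** * Weak convergence and height functions *)

Section WeakToHeight.
Variable R : realType.
Implicit Types (m : {measure set (plane R) -> \bar R}).

Let Q : set (plane R) := unit_square.

Let mQ : measurable Q. Proof. exact: measurable_rect. Qed.

Lemma uniform_marginals_mass m : uniform_marginals m -> m unit_square = 1%E.
Proof. by move=> um; have [-> _] := um 0 1 (lexx _) ler01 (lexx _); rewrite subr0. Qed.

(* Equal to 1 on the quadrant [a, +oo[ x ]-oo, b] and to 0 outside of
   its [e]-neighborhood. *)
Let ramp (a b e : R) (z : R * R) : R :=
  Num.min 1 (Num.max 0 (Num.min (1 + (z.1 - a) / e) (1 + (b - z.2) / e))).

Let ramp01 a b e z : 0 <= ramp a b e z <= 1.
Proof. by rewrite /ramp le_min ler01 le_max lexx ge_min lexx. Qed.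

Let ramp_eq1 a b e z : 0 < e -> a <= z.1 -> z.2 <= b -> ramp a b e z = 1.
Proof.
move=> e0 az zb; have h1 : 0 <= (z.1 - a) / e by rewrite divr_ge0 ?subr_ge0 // ltW.
have h2 : 0 <= (b - z.2) / e by rewrite divr_ge0 ?subr_ge0 // ltW.
rewrite /ramp min_l // le_max; apply/orP; right.
by rewrite le_min !lerDl h1.
Qed.

Let ramp_supp a b e z : 0 < e -> ramp a b e z != 0 -> a - e <= z.1 /\ z.2 <= b + e.
Proof.
move=> e0 neq0; split; rewrite leNgt; apply/negP => lt_z; move/eqP: neq0; apply.
  have h : (z.1 - a) / e < - 1 by rewrite ltr_pdivrMr // mulN1r; lra.
  have h' : Num.min (1 + (z.1 - a) / e) (1 + (b - z.2) / e) <= 0.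
    by rewrite ge_min; apply/orP; left; lra.
  by rewrite /ramp (max_l h') min_r.
have h : (b - z.2) / e < - 1 by rewrite ltr_pdivrMr // mulN1r; lra.
have h' : Num.min (1 + (z.1 - a) / e) (1 + (b - z.2) / e) <= 0.
  by rewrite ge_min; apply/orP; right; lra.
by rewrite /ramp (max_l h') min_r.
Qed.

Let ramp_continuous a b e : continuous (ramp a b e).
Proof.
have c0 (c : R) : continuous (fun _ : R * R => c) by move=> z; exact: cvg_cst.
have c1 : continuous (fun z : R * R => 1 + (z.1 - a) / e).
  move=> z; apply: cvgD; first exact: cvg_cst.
  apply: cvgM; last exact: cvg_cst.
  by apply: cvgB; [exact: cvg_fst|exact: cvg_cst].
have c2 : continuous (fun z : R * R => 1 + (b - z.2) / e).
  move=> z; apply: cvgD; first exact: cvg_cst.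
  apply: cvgM; last exact: cvg_cst.
  by apply: cvgB; [exact: cvg_cst|exact: cvg_snd].
move=> z.
exact: (continuous_min (c0 1 z) (continuous_max (c0 0 z) (continuous_min (c1 z) (c2 z)))).
Qed.

Let ramp_measurable a b e : measurable_fun Q (fun z => (ramp a b e z)%:E).
Proof.
apply/measurable_EFinP; apply: (@measurable_funS _ _ _ _ setT) => //.
apply: measurable_minr; first exact: measurable_cst.
apply: measurable_maxr; first exact: measurable_cst.
apply: measurable_minr; apply: measurable_funD; try exact: measurable_cst.
  apply: measurable_funM; last exact: measurable_cst.
  by apply: measurable_funB; [exact: measurable_fst|exact: measurable_cst].
apply: measurable_funM; last exact: measurable_cst.
by apply: measurable_funB; [exact: measurable_cst|exact: measurable_snd].
Qed.

Let quadrant (a b : R) : set (plane R) := `[a, +oo[ `*` `]-oo, b].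

Let mquadrant a b : measurable (quadrant a b). Proof. exact: measurable_rect. Qed.

Let ramp_ge m a b e : 0 < e ->
  (m (quadrant a b `&` Q) <= \int[m]_(z in Q) (ramp a b e z)%:E)%E.
Proof.
move=> e0; rewrite -integral_indic //.
apply: ge0_le_integral => //.
- by apply/measurable_EFinP; exact: measurable_indic.
- move=> z _; rewrite lee_fin indicE; have [zq|_] := boolP (z \in _); last by have /andP[] := ramp01 a b e z.
  move/set_mem : zq => -[] /=; rewrite !in_itv /= andbT => az zb.
  by rewrite ramp_eq1.
Qed.

Let ramp_le m a b e : 0 < e ->
  (\int[m]_(z in Q) (ramp a b e z)%:E <= m (quadrant (a - e) (b + e) `&` Q))%E.
Proof.
move=> e0; rewrite -integral_indic //.
apply: ge0_le_integral => //.
- by move=> z _; rewrite lee_fin; have /andP[] := ramp01 a b e z.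
- by apply/measurable_EFinP; exact: measurable_indic.
- move=> z _; rewrite lee_fin indicE; have /andP[r0 r1] := ramp01 a b e z.
  have [->|r_neq0] := eqVneq (ramp a b e z) 0; first by case: (_ \in _).
  have [az zb] := ramp_supp e0 r_neq0.
  by rewrite mem_set //; split; rewrite /= in_itv /= ?andbT.
Qed.

Let quadrantE m (x y : R) : 0 <= x <= 1 -> 0 <= y <= 1 ->
  m (quadrant x y `&` Q) = height m x y.
Proof.
move=> /andP[x0 x1] /andP[y0 y1]; rewrite /height; congr (m _).
apply/seteqP; split=> z; rewrite /Q /unit_square /quadrant /= !in_itv /= !andbT.
  by move=> [[-> ->] [/andP[_ ->] /andP[-> _]]].
by move=> [/andP[xz ->] /andP[-> zy]]; rewrite xz zy (le_trans x0) // (le_trans zy).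
Qed.

Let quadrant_ub m (x y e : R) : uniform_marginals m -> 0 <= x <= 1 -> 0 <= y <= 1 -> 0 < e ->
  (m (quadrant (x - e) (y + e) `&` Q) <= (fheight m x y + 2 * e)%:E)%E.
Proof.
move=> um x01 y01 e0; have /andP[x0 x1] := x01; have /andP[y0 y1] := y01.
pose a := Num.max 0 (x - e); pose b := Num.min 1 (y + e).
have a01 : 0 <= a <= 1 by rewrite /a le_max lexx ge_max ler01 /=; lra.
have b01 : 0 <= b <= 1 by rewrite /b le_min ler01 ge_min lexx /= andbT; lra.
have -> : quadrant (x - e) (y + e) `&` Q = quadrant a b `&` Q.
  apply/seteqP; split=> z; rewrite /Q /unit_square /quadrant /= !in_itv /= !andbT.
    move=> [[h1 h2] [/andP[z0 z1] /andP[z0' z1']]].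
    by rewrite /a /b ge_max le_min z0 h1 h2 z1' z1 z0'.
  rewrite /a /b ge_max le_min => -[[/andP[_ ->] /andP[_ ->]] ?].
  by [].
rewrite quadrantE // fheightE // lee_fin -lerBlDl.
apply: le_trans (ler_norm _) _.
apply: le_trans (height_fun_dist (fheight_is_height_fun um) a01 x01 b01 y01) _.
have ax : `|a - x| <= e.
  by rewrite /a; case: (leP 0 (x - e)) => h; [rewrite ler0_norm|rewrite ler0_norm]; lra.
have yb : `|b - y| <= e.
  by rewrite /b; case: (leP 1 (y + e)) => h; [rewrite ger0_norm|rewrite ger0_norm]; lra.
by lra.
Qed.

Let quadrant_lb m (x y e : R) : uniform_marginals m -> 0 <= x <= 1 -> 0 <= y <= 1 -> 0 < e ->
  ((fheight m x y - 2 * e)%:E <= m (quadrant (x + e) (y - e) `&` Q))%E.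
Proof.
move=> um x01 y01 e0; have /andP[x0 x1] := x01; have /andP[y0 y1] := y01.
have hm := fheight_is_height_fun um; have [H0 H1 Hx0 Hx1 Hmono] := hm.
have in0 : 0 <= (0 : R) <= 1 by rewrite lexx ler01.
have in1 : 0 <= (1 : R) <= 1 by rewrite lexx ler01.
(* If the shifted corner leaves the square, then [(x, y)] is within [e] of a side where the height
   vanishes, and the left side is negative. *)
have [xe|xe] := leP (x + e) 1; last first.
  apply: (@le_trans _ _ 0%E); last exact: measure_ge0.
  rewrite lee_fin; have := height_fun_dist hm x01 in1 y01 y01.
  rewrite H1 // subrr normr0 addr0 subr0 => /ler_normlW; rewrite ler0_norm; lra.
have [ye|ye] := leP 0 (y - e); last first.
  apply: (@le_trans _ _ 0%E); last exact: measure_ge0.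
  rewrite lee_fin; have := height_fun_dist hm x01 x01 y01 in0.
  rewrite Hx0 // subrr normr0 add0r !subr0 => /ler_normlW; rewrite ger0_norm; lra.
have xe01 : 0 <= x + e <= 1 by lra.
have ye01 : 0 <= y - e <= 1 by lra.
rewrite quadrantE // fheightE // lee_fin.
have := ler_normlW (height_fun_dist hm x01 xe01 y01 ye01).
have -> : x - (x + e) = - e by ring.
have -> : y - (y - e) = e by ring.
by rewrite normrN !ger0_norm; lra.
Qed.

(** The ramp at [(x, y)] bounds the heights from above and the one at [(x + d, y - d)] from below,
    for every [n]. Only the limit needs a reverse estimate, which the Lipschitz bound provides. *)
Lemma weak_cvg_fheight (m_ : nat -> {measure set (plane R) -> \bar R}) m (x y : R) :
  uniform_marginals m -> (\forall n \near \oo, uniform_marginals (m_ n)) ->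
  weak_cvg m_ m -> 0 <= x <= 1 -> 0 <= y <= 1 ->
  fheight (m_ n) x y @[n --> \oo] --> fheight m x y.
Proof.
move=> um um_ wc x01 y01.
have finI k a b e : uniform_marginals k -> 0 < e ->
    (\int[k]_(z in Q) (ramp a b e z)%:E)%E \is a fin_num.
  move=> uk e0; rewrite ge0_fin_numE; last first.
    by apply: integral_ge0 => z _; rewrite lee_fin; have /andP[] := ramp01 a b e z.
  apply: le_lt_trans (ramp_le _ _ _ e0) _.
  apply: (@le_lt_trans _ _ (k Q)).
    by apply: le_measure; rewrite ?inE //; exact: measurableI.
  by rewrite uniform_marginals_mass // ltry.
pose I k a b e := fine (\int[k]_(z in Q) (ramp a b e z)%:E)%E.
have IE k a b e : uniform_marginals k -> 0 < e ->
    (\int[k]_(z in Q) (ramp a b e z)%:E)%E = (I k a b e)%:E.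
  by move=> uk e0; rewrite fineK // finI.
have Icvg a b e : 0 < e -> I (m_ n) a b e @[n --> \oo] --> I m a b e.
  move=> e0; apply: fine_cvg; rewrite -/(I m a b e) -IE //.
  by apply: wc; apply: continuous_subspaceT; exact: ramp_continuous.
(* The ramp width costs [2 * d] for the limit measure, and the convergence of the ramp integrals
   costs another [d]. *)
apply/cvgrPdist_le => /= e e0; pose d := e / 3; have d0 : 0 < d by rewrite divr_gt0.
have /cvgrPdist_le/(_ d d0) up := Icvg x y d d0.
have /cvgrPdist_le/(_ d d0) lo := Icvg (x + d) (y - d) d d0.
have uub := le_trans (ramp_le m x y d0) (quadrant_ub um x01 y01 d0).
have llb := le_trans (quadrant_lb um x01 y01 d0) (ramp_ge m (x + d) (y - d) d0).
rewrite IE // lee_fin in uub; rewrite IE // lee_fin in llb.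
near=> n; have un : uniform_marginals (m_ n) by near: n.
have h1 : fheight (m_ n) x y <= I (m_ n) x y d.
  by rewrite -lee_fin -fheightE // -IE // -quadrantE // ramp_ge.
have h2 : I (m_ n) (x + d) (y - d) d <= fheight (m_ n) x y.
  rewrite -lee_fin -fheightE // -IE // -quadrantE //.
  by have := ramp_le (m_ n) (x + d) (y - d) d0; rewrite addrK subrK.
have h3 : `|I m x y d - I (m_ n) x y d| <= d by near: n.
have h4 : `|I m (x + d) (y - d) d - I (m_ n) (x + d) (y - d) d| <= d by near: n.
have := ler_normlW h4; have := h3; rewrite distrC => /ler_normlW.
have de : e = 3 * d by rewrite /d; field.
move=> h5 h6; rewrite ler_norml; lra.
Unshelve. all: end_near. Qed.

End WeakToHeight.

(** * From height functions to weak convergence *)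

Section HeightToWeak.
Variable R : realType.
Implicit Types (m : {measure set (plane R) -> \bar R}) (f : R * R -> R).

Let Q : set (plane R) := unit_square.

Let mQ : measurable Q. Proof. exact: measurable_rect. Qed.

(** Heine's theorem, with the modulus expressed as the mesh of a grid. Compactness enters as a
    near-covering property, and the radius [d / 2] keeps both points in the ball where continuity at
    the centre applies. *)
Lemma unit_square_unif_continuous f : {within unit_square, continuous f} ->
  forall e : R, 0 < e -> \forall N \near \oo, forall z z' : R * R,
    unit_square z -> unit_square z' ->
    `|z.1 - z'.1| <= N.+1%:R^-1 -> `|z.2 - z'.2| <= N.+1%:R^-1 -> `|f z - f z'| <= e.
Proof.
move=> cf e e0.
have cQ : compact (unit_square : set (R * R)).
  by apply: compact_setX; exact: segment_compact.
have /compact_near_coveringP/near_covering_withinP cov := cQ.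
have := cov nat \oo (fun N z => forall z' : R * R, unit_square z' ->
  `|z.1 - z'.1| <= N.+1%:R^-1 -> `|z.2 - z'.2| <= N.+1%:R^-1 -> `|f z - f z'| <= e) _.
have cov_loc x : unit_square x -> \forall x' \near x & N \near \oo, unit_square x' ->
    forall z', unit_square z' -> `|x'.1 - z'.1| <= N.+1%:R^-1 ->
    `|x'.2 - z'.2| <= N.+1%:R^-1 -> `|f x' - f z'| <= e.
  move=> Qx; have /subspace_continuousP/(_ x Qx)/cvgrPdist_lt/(_ (e / 2)) := cf.
  rewrite divr_gt0 // => /(_ isT).
  rewrite /prop_near1 /within /= => /nbhs_ballP [d /= d0 ball_d].
  have d2 : 0 < d / 2 by rewrite divr_gt0.
  exists (ball x (d / 2), [set N | N.+1%:R^-1 < d / 2]) => /=.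
    split; first exact: nbhsx_ballx.
    exact: near_infty_natSinv_lt (PosNum d2).
  move=> [x' N] /= [[bx1 bx2] Nd] Qx' z' Qz' h1 h2.
  have fx' : `|f x - f x'| < e / 2.
    apply: ball_d => //; split; rewrite /ball /= in bx1 bx2 *.
      by apply: lt_trans bx1 _; lra.
    by apply: lt_trans bx2 _; lra.
  have fz' : `|f x - f z'| < e / 2.
    apply: ball_d => //; split; rewrite /ball /= in bx1 bx2 *.
      have -> : x.1 - z'.1 = (x.1 - x'.1) + (x'.1 - z'.1) by ring.
      by apply: le_lt_trans (ler_normD _ _) _; rewrite [ltRHS]splitr ltrD // (le_lt_trans h1).
    have -> : x.2 - z'.2 = (x.2 - x'.2) + (x'.2 - z'.2) by ring.
    by apply: le_lt_trans (ler_normD _ _) _; rewrite [ltRHS]splitr ltrD // (le_lt_trans h2).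
  have -> : f x' - f z' = (f x - f z') - (f x - f x') by ring.
  by apply: le_trans (ler_normB _ _) _; lra.
move=> /(_ _ cov_loc); apply: filterS => N h z z' Qz Qz'.
exact: h.
Qed.

Definition rect_mass m (x x' y y' : R) : R :=
  fheight m x y' - fheight m x' y' - fheight m x y + fheight m x' y.

(** Uniform marginals give mass 0 to vertical and horizontal segments of the square, so it does not
    matter which sides of the rectangle belong to [A]. *)
Lemma measure_rect_between m (x x' y y' : R) (A : set (plane R)) : uniform_marginals m ->
  0 <= x -> x <= x' -> x' <= 1 -> 0 <= y -> y <= y' -> y' <= 1 -> measurable A ->
  `]x, x'[ `*` `]y, y'[ `<=` A -> A `<=` `[x, x'] `*` `[y, y'] ->
  m A = (rect_mass m x x' y y')%:E.
Proof.
move=> um x0 xx' x'1 y0 yy' y'1 mA sub1 sub2.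
have semiE := measure_semi_open_rect um x0 xx' x'1 y0 yy' y'1.
have mS : measurable (`[x, x'[ `*` `]y, y'] : set (plane R)) by exact: measurable_rect.
have row0 (b : R) : 0 <= b -> b <= 1 -> m (`[0, 1] `*` `[b, b]) = 0%E.
  by move=> b0 b1; have [-> _] := um b b b0 (lexx _) b1; rewrite subrr.
have col0 (a : R) : 0 <= a -> a <= 1 -> m (`[a, a] `*` `[0, 1]) = 0%E.
  by move=> a0 a1; have [_ ->] := um a a a0 (lexx _) a1; rewrite subrr.
have le_lines (B C : set (plane R)) (a b : R) : measurable B -> measurable C -> 0 <= a -> a <= 1 -> 0 <= b -> b <= 1 ->
    B `<=` C `|` (`[a, a] `*` `[0, 1] `|` `[0, 1] `*` `[b, b]) -> (m B <= m C)%E.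
  move=> mB mC a0 a1 b0 b1 sub.
  have ml1 : measurable (`[a, a] `*` `[0, 1] : set (plane R)) by exact: measurable_rect.
  have ml2 : measurable (`[0, 1] `*` `[b, b] : set (plane R)) by exact: measurable_rect.
  have ml := measurableU _ _ ml1 ml2.
  apply: (@le_trans _ _ (m (C `|` (`[a, a] `*` `[0, 1] `|` `[0, 1] `*` `[b, b])))).
    by apply: le_measure; rewrite ?inE //; exact: measurableU.
  apply: le_trans (measureU2 _ mC ml) _.
  rewrite -[leRHS]adde0 leeD2l //.
  by apply: le_trans (measureU2 _ ml1 ml2) _; rewrite [X in (X + _)%E]col0 // [X in (_ + X)%E]row0 // adde0.
have x'0 := le_trans x0 xx'; have y'0 := le_trans y0 yy'.
have x1 := le_trans xx' x'1; have y1 := le_trans yy' y'1.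
rewrite -semiE; apply/eqP; rewrite eq_le; apply/andP; split.
  apply: (le_lines _ _ x' y) => // z /sub2 [] /=; rewrite !in_itv /= => /andP[xz zx'] /andP[yz zy'].
  have z1 : 0 <= z.1 <= 1 by rewrite (le_trans x0) // (le_trans zx').
  have z2 : 0 <= z.2 <= 1 by rewrite (le_trans y0) // (le_trans zy').
  have [lt1|ge1] := ltP z.1 x'; last first.
    by right; left; split; rewrite /= ?in_itv /= ?z2 ?ge1 ?zx'.
  have [lt2|ge2] := ltP y z.2; last first.
    by right; right; split; rewrite /= ?in_itv /= ?z1 ?ge2 ?yz.
  by left; split; rewrite /= ?in_itv /= ?xz ?lt1 ?lt2 ?zy'.
apply: (le_lines _ _ x y') => // z [] /=; rewrite !in_itv /= => /andP[xz zx'] /andP[yz zy'].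
have z1 : 0 <= z.1 <= 1 by rewrite (le_trans x0) // (le_trans (ltW zx')).
have z2 : 0 <= z.2 <= 1 by rewrite (le_trans y0) ?(ltW yz) // (le_trans zy').
have [lt1|ge1] := ltP x z.1; last first.
  by right; left; split; rewrite /= ?in_itv /= ?z2 ?ge1 ?xz.
have [lt2|ge2] := ltP z.2 y'; last first.
  by right; right; split; rewrite /= ?in_itv /= ?z1 ?ge2 ?zy'.
by left; apply: sub1; split; rewrite /= ?in_itv /= ?lt1 ?zx' ?yz ?lt2.
Qed.

Lemma integrable_unit_square m (g : plane R -> R) (M : R) : uniform_marginals m ->
  measurable_fun Q g -> (forall z, unit_square z -> `|g z| <= M) ->
  m.-integrable Q (EFin \o g).
Proof.
move=> um mg gM; apply: measurable_bounded_integrable => //.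
  by rewrite [ltLHS](uniform_marginals_mass um) ltry.
exists M; split; first exact: num_real.
by move=> K MK z Qz /=; rewrite (le_trans (gM z Qz)) // ltW.
Qed.

Section Grid.
Variables (f : R * R -> R) (N : nat).
Let r (i : nat) : R := i%:R / N.+1%:R.
Let cell (i : nat) : set (measurableTypeR R) := `[r i, r i.+1[.
(** One index more than the [N.+1] cells of [[0, 1[]: the last cell starts at 1 and is there to
    contain that point. *)
Let idx : finType := ('I_N.+2 * 'I_N.+2)%type.
Let cell2 (p : idx) : set (plane R) := cell p.1 `*` cell p.2.

Definition grid_step (z : plane R) : R :=
  \sum_(p : idx) f (r p.1, r p.2) * \1_(cell2 p) z.

Let N0 : 0 < N.+1%:R :> R. Proof. by rewrite ltr0n. Qed.

Let r01 (i : 'I_N.+2) : 0 <= r i <= 1.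
Proof. by rewrite divr_ge0 //= ler_pdivrMr // mul1r ler_nat -ltnS. Qed.

Let cell_ex (t : R) : 0 <= t <= 1 -> exists i : 'I_N.+2, cell i t.
Proof.
move=> /andP[t0 t1]; have tN : 0 <= t * N.+1%:R by rewrite mulr_ge0.
have /andP[le_t lt_t] := truncn_itv tN.
have ltN : (Num.truncn (t * N.+1%:R) < N.+2)%N.
  by rewrite ltnS -(ler_nat R) (le_trans le_t) // ler_piMl.
exists (Ordinal ltN); rewrite /cell /= in_itv /= /r.
by rewrite ler_pdivrMr // le_t ltr_pdivlMr.
Qed.

Let cell_inj (i j : nat) (t : R) : cell i t -> cell j t -> i = j.
Proof.
rewrite /cell /= !in_itv /= => /andP[it ti] /andP[jt tj].
have := le_lt_trans it tj; have := le_lt_trans jt ti.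
rewrite !ltr_pM2r ?invr_gt0 // !ltr_nat !ltnS => ji ij.
by apply/eqP; rewrite eqn_leq ij ji.
Qed.

Let cell_dist (i : nat) (t : R) : cell i t -> `|t - r i| <= N.+1%:R^-1.
Proof.
rewrite /cell /= in_itv /= => /andP[it ti]; rewrite ger0_norm ?subr_ge0 // lerBlDl ltW //.
by apply: lt_le_trans ti _; rewrite /r -natr1 mulrDl mul1r.
Qed.

Lemma grid_stepE (z : R * R) : unit_square z -> exists2 w : R * R, unit_square w &
  [/\ grid_step z = f w, `|z.1 - w.1| <= N.+1%:R^-1 & `|z.2 - w.2| <= N.+1%:R^-1].
Proof.
move=> [] /=; rewrite !in_itv /= => z1 z2.
have [i ci] := cell_ex z1; have [j cj] := cell_ex z2.
exists (r i, r j); first by split; rewrite /= ?in_itv; exact: r01.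
split; [|exact: cell_dist|exact: cell_dist].
rewrite /grid_step (bigD1 (i, j)) //= big1 ?addr0 => [|[i' j'] /= neq].
  by rewrite indicE mem_set ?mulr1.
rewrite indicE memNset ?mulr0 // => -[/= ci' cj'].
move: neq; rewrite xpair_eqE; apply/negP; rewrite negbK; apply/andP.
by split; apply/eqP/val_inj; [exact: cell_inj ci' ci|exact: cell_inj cj' cj].
Qed.

Let mcell2 (p : idx) : measurable (cell2 p).
Proof. exact: measurable_rect. Qed.

Lemma grid_step_measurable : measurable_fun Q grid_step.
Proof.
apply: measurable_sum => p; apply: measurable_funM; first exact: measurable_cst.
exact: measurable_indic.
Qed.

(** Clipping at 1 keeps the corners in the square; for the last index the rectangle degenerates. *)
Let top (i : nat) : R := Num.min 1 (r i.+1).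

Definition grid_sum m : R :=
  \sum_(p : idx) f (r p.1, r p.2) * rect_mass m (r p.1) (top p.1) (r p.2) (top p.2).

Lemma grid_step_bounded : exists M, forall z, `|grid_step z| <= M.
Proof.
exists (\sum_(p : idx) `|f (r p.1, r p.2)|) => z.
apply: le_trans (ler_norm_sum _ _ _) _; apply: ler_sum => p _.
by rewrite normrM indicE; case: (_ \in _); rewrite ?normr1 ?normr0 ?mulr1 ?mulr0.
Qed.

Let top_le (i : 'I_N.+2) : [/\ 0 <= r i, r i <= top i & top i <= 1].
Proof.
have /andP[ri0 ri1] := r01 i; rewrite /top le_min ri1 ge_min lexx /=; split=> //.
by rewrite ler_pM2r ?invr_gt0 // ler_nat.
Qed.

Lemma grid_sum_cvg (m_ : nat -> {measure set (plane R) -> \bar R}) m :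
  (forall x y : R, 0 <= x <= 1 -> 0 <= y <= 1 ->
    fheight (m_ n) x y @[n --> \oo] --> fheight m x y) ->
  grid_sum (m_ n) @[n --> \oo] --> grid_sum m.
Proof.
move=> h; rewrite /grid_sum; apply: cvg_big => [|p _]; first exact: add_continuous.
apply: cvgM; first exact: cvg_cst.
have top01 (i : 'I_N.+2) : 0 <= top i <= 1.
  by have [r0 rt ->] := top_le i; rewrite (le_trans r0).
rewrite /rect_mass.
by apply: cvgD; [apply: cvgB; [apply: cvgB|]|]; apply: h.
Qed.

Lemma grid_step_integral m : uniform_marginals m ->
  (\int[m]_(z in Q) (grid_step z)%:E)%E = (grid_sum m)%:E.
Proof.
move=> um; have mQ1 : m Q = 1%E := uniform_marginals_mass um.
have int_ind (p : idx) : m.-integrable Q (fun z => (\1_(cell2 p) z)%:E).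
  apply: (@integrable_unit_square m (\1_(cell2 p)) 1) => //.
  by move=> z _; rewrite indicE; case: (_ \in _); rewrite ?normr1 ?normr0.
under eq_integral do rewrite -sumEFin.
rewrite integral_sum //; last first.
  move=> p; rewrite (_ : (fun _ => _) = (fun z => (f (r p.1, r p.2))%:E * (\1_(cell2 p) z)%:E)%E) //.
  exact: integrableZl.
rewrite /grid_sum -sumEFin; apply: eq_bigr => p _.
under eq_integral do rewrite EFinM.
rewrite integralZl // EFinM; congr (_ * _)%E.
rewrite integral_indic //.
have [a0 ab b1] := top_le p.1; have [c0 cd d1] := top_le p.2.
apply: measure_rect_between => //; first exact: measurableI.
- move=> z [] /=; rewrite !in_itv /= => /andP[h1 h2] /andP[h3 h4].
  move: h2 h4; rewrite !lt_min => /andP[h2 h2'] /andP[h4 h4'].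
  split; first by split; rewrite /cell /= in_itv /= ltW.
  split; rewrite /= ?in_itv /= ?(ltW h2) ?(ltW h4) andbT.
    by rewrite (le_trans a0) // ltW.
  by rewrite (le_trans c0) // ltW.
move=> z [[]]; rewrite /cell /= !in_itv /= => /andP[h1 h2] /andP[h3 h4] [].
rewrite /= !in_itv /= => /andP[_ z1] /andP[_ z2].
by split; rewrite /= ?in_itv /= le_min ?h1 ?h3 ?z1 ?z2 /= ltW.
Qed.

End Grid.

(** Since the measures have mass 1, replacing [f] by a uniformly close step function costs the same
    for all of them. The integral of the step function is a finite combination of heights, which
    converges. *)
Lemma cvg_fheight_weak (m_ : nat -> {measure set (plane R) -> \bar R}) m :
  uniform_marginals m -> (\forall n \near \oo, uniform_marginals (m_ n)) ->
  (forall x y : R, 0 <= x <= 1 -> 0 <= y <= 1 ->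
    fheight (m_ n) x y @[n --> \oo] --> fheight m x y) ->
  weak_cvg m_ m.
Proof.
move=> um um_ h f cf; have unif := unit_square_unif_continuous cf.
have approx (e : R) : 0 < e -> \forall N \near \oo, forall z, unit_square z ->
    `|f z - grid_step f N z| <= e.
  move=> e0; apply: filterS (unif e e0) => N hN z Qz.
  by have [w Qw [-> h1 h2]] := grid_stepE f N Qz; exact: hN.
(* [f] is continuous only within the square; measurability there is obtained from its uniform
   approximation by step functions. *)
have mf : measurable_fun Q (f : plane R -> R).
  apply: (measurable_fun_cvg (h := fun N => grid_step f N)) => [N|z Qz].
    exact: grid_step_measurable.
  apply/cvgrPdist_le => e e0; apply: filterS (approx e e0) => N hN; exact: hN.
have [M fM] : exists M, forall z, unit_square z -> `|f z| <= M.
  have [N _ /(_ N (leqnn N)) hN] := approx 1 ltr01.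
  have [M gM] := grid_step_bounded f N; exists (1 + M) => z Qz.
  have -> : f z = (f z - grid_step f N z) + grid_step f N z by ring.
  by apply: le_trans (ler_normD _ _) _; rewrite lerD // hN.
have int_f k : uniform_marginals k -> k.-integrable Q (EFin \o (f : plane R -> R)).
  by move=> uk; exact: integrable_unit_square fM.
have int_g k N : uniform_marginals k -> k.-integrable Q (EFin \o grid_step f N).
  move=> uk; have [K gK] := grid_step_bounded f N.
  apply: (integrable_unit_square (M := K)) => //; exact: grid_step_measurable.
have dist k N (e : R) : uniform_marginals k -> (forall z, unit_square z -> `|f z - grid_step f N z| <= e) ->
    `|\int[k]_(z in Q) f z - grid_sum f N k| <= e.
  move=> uk hN.
  have -> : grid_sum f N k = \int[k]_(z in Q) grid_step f N z.
    by rewrite /Rintegral grid_step_integral.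
  rewrite -RintegralB //; [|exact: int_f|exact: int_g].
  have mfg : measurable_fun Q (fun z : plane R => f z - grid_step f N z).
    by apply: measurable_funB => //; exact: grid_step_measurable.
  apply: le_trans (le_normr_Rintegral _ _) _ => //.
    exact: integrable_unit_square hN.
  have -> : e = \int[k]_(z in Q) e.
    by rewrite Rintegral_cst // [X in fine X](uniform_marginals_mass uk) mulr1.
  apply: le_Rintegral => //.
  - apply: (integrable_unit_square (M := e)) => //.
      by apply: measurableT_comp.
    by move=> z Qz; rewrite normr_id; exact: hN.
  - apply: (integrable_unit_square (M := `|e|)) => //.
have intE k : uniform_marginals k ->
    (\int[k]_(z in Q) (f z)%:E)%E = (\int[k]_(z in Q) f z)%:E.
  by move=> uk; rewrite fineK //; apply: integrable_fin_num => //; exact: int_f.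
rewrite [X in _ --> X]intE //; apply: cvg_EFin.
  by apply: filterS um_ => n un; rewrite [X in X \is a fin_num]intE.
apply/cvgrPdist_le => /= e e0; have e3 : 0 < e / 3 by rewrite divr_gt0.
have [N _ /(_ N (leqnn N)) hN] := approx _ e3.
have /cvgrPdist_le/(_ _ e3) hS := @grid_sum_cvg f N m_ m h.
near=> n; have un : uniform_marginals (m_ n) by near: n.
have h1 := dist _ _ _ um hN; have h2 := dist _ _ _ un hN.
have h3 : `|grid_sum f N m - grid_sum f N (m_ n)| <= e / 3 by near: n.
rewrite -[fine _]/(\int[m_ n]_(z in Q) f z).
set a := Rintegral _ _ _ in h1 *; set b := Rintegral _ _ _ in h2 *.
have -> : a - b = (a - grid_sum f N m) + (grid_sum f N m - grid_sum f N (m_ n))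
                  - (b - grid_sum f N (m_ n)) by ring.
apply: le_trans (ler_normB _ _) _.
have := ler_normD (a - grid_sum f N m) (grid_sum f N m - grid_sum f N (m_ n)).
lra.
Unshelve. all: end_near. Qed.

End HeightToWeak.

(** * Passage to the limit in the min-plus formula *)

Section Limit.
Variable R : realType.

Lemma unit_grid_approx (n : nat) (t : R) : (0 < n)%N -> 0 <= t <= 1 ->
  exists k : 'I_n.+1, 0 <= (k%:R / n%:R : R) <= 1 /\ `|t - k%:R / n%:R| <= n%:R^-1.
Proof.
move=> n0 /andP[t0 t1]; have nR : 0 < n%:R :> R by rewrite ltr0n.
have tn : 0 <= t * n%:R by rewrite mulr_ge0.
have /andP[le_t lt_t] := truncn_itv tn.
have ltN : (Num.truncn (t * n%:R) < n.+1)%N.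
  by rewrite ltnS -(ler_nat R) (le_trans le_t) // ler_piMl.
exists (Ordinal ltN) => /=; split.
  by rewrite divr_ge0 //= ler_pdivrMr // mul1r ler_nat -ltnS.
rewrite ger0_norm ?subr_ge0 ?ler_pdivrMr // lerBlDl.
rewrite -[X in _ + X]mul1r -mulrDl natr1 ler_pdivlMr //.
exact: ltW.
Qed.

(* On the grid of step [1/n] this is [perm_height_demazure]; elsewhere the error
   is controlled by the Lipschitz bound on height functions. *)
Lemma demazure_fheight (n : nat) (u v : 'S_n) (x y : R) : (0 < n)%N ->
  0 <= x <= 1 -> 0 <= y <= 1 ->
  (forall g : R, 0 <= g <= 1 -> fheight (perm_permuton (demazure u v)) x y <=
     fheight (perm_permuton u) g y + fheight (perm_permuton v) x g + 6 * n%:R^-1) /\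
  exists2 g : R, 0 <= g <= 1 &
    fheight (perm_permuton u) g y + fheight (perm_permuton v) x g <=
    fheight (perm_permuton (demazure u v)) x y + 6 * n%:R^-1.
Proof.
(* With [e = 1/n]: three heights are moved to the grid, each by at most [e] in both variables, so
   the total error is [3 * 2 * e]. *)
have up (e a b c p q r : R) : a - p <= 2 * e -> q - b <= 2 * e -> r - c <= 2 * e ->
    p <= q + r -> a <= b + c + 6 * e by lra.
have lo (e a b c p q r : R) : p - a <= 2 * e -> b - q <= 2 * e -> c - r <= 2 * e ->
    p = q + r -> b + c <= a + 6 * e by lra.
move=> n0 x01 y01; have nR : 0 < n%:R :> R by rewrite ltr0n.
have hf (w : 'S_n) := fheight_is_height_fun (@perm_permuton_uniform R n n0 w).
have [k [k01 xk]] := unit_grid_approx n0 x01.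
have [l [l01 yl]] := unit_grid_approx n0 y01.
have kn : (k <= n)%N by rewrite -ltnS.
have ln : (l <= n)%N by rewrite -ltnS.
have gridE (w : 'S_n) (i j : nat) : (i <= n)%N -> (j <= n)%N ->
    fheight (perm_permuton w) (i%:R / n%:R) (j%:R / n%:R) = (perm_height w i j)%:R / n%:R :> R.
  by move=> iN jN; rewrite perm_permuton_fheight.
have dist (w : 'S_n) (a a' b b' : R) : 0 <= a <= 1 -> 0 <= a' <= 1 -> 0 <= b <= 1 ->
    0 <= b' <= 1 -> `|a - a'| <= n%:R^-1 -> `|b - b'| <= n%:R^-1 ->
    fheight (perm_permuton w) a b - fheight (perm_permuton w) a' b' <= 2 * n%:R^-1 /\
    fheight (perm_permuton w) a' b' - fheight (perm_permuton w) a b <= 2 * n%:R^-1.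
  move=> a01 a'01 b01 b'01 aa' bb'.
  have := height_fun_dist (hf w) a01 a'01 b01 b'01; rewrite ler_norml => /andP[].
  move: aa' bb'; move: `|a - a'| `|b - b'| (fheight _ a b) (fheight _ a' b') n%:R^-1.
  by clear => p q s t r; lra.
have [le_min [j jn minE]] := perm_height_demazure u v l kn.
have [w1 w2] := dist (demazure u v) _ _ _ _ x01 k01 y01 l01 xk yl.
rewrite gridE // in w1; rewrite gridE // in w2.
split=> [g g01|].
  have [i [i01 gi]] := unit_grid_approx n0 g01.
  have iN : (i <= n)%N by rewrite -ltnS.
  have [_ u2] := dist u _ _ _ _ g01 i01 y01 l01 gi yl.
  have [_ v2] := dist v _ _ _ _ x01 k01 g01 i01 xk gi.
  rewrite gridE // in u2; rewrite gridE // in v2.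
  have := le_min i iN; rewrite -(ler_nat R) natrD => h.
  by apply: up w1 u2 v2 _; rewrite -mulrDl ler_pM2r ?invr_gt0.
have j01 : 0 <= (j%:R / n%:R : R) <= 1.
  by rewrite divr_ge0 //= ler_pdivrMr // mul1r ler_nat.
have jj : `|j%:R / n%:R - j%:R / n%:R| <= n%:R^-1 :> R by rewrite subrr normr0 invr_ge0.
exists (j%:R / n%:R) => //.
have [u1 _] := dist u _ _ _ _ j01 j01 y01 l01 jj yl.
have [v1 _] := dist v _ _ _ _ x01 k01 j01 j01 xk jj.
rewrite gridE // in u1; rewrite gridE // in v1.
by apply: lo w2 u1 v1 _; rewrite minE natrD mulrDl.
Qed.

(** For the upper bound, a fixed minimizer [g] of the limit is tested. For the lower bound, the
    minimizer [g'] depends on [n]; it is moved to a point of a fixed finite grid, where convergence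
    is uniform, at a cost controlled by the Lipschitz bounds of [U n] and [V n]. *)
Lemma minplus_cvg (H K M : R -> R -> R) (U V W : nat -> R -> R -> R) (eps : nat -> R) :
  is_minplus H K M -> is_height_fun H -> is_height_fun K ->
  (\forall n \near \oo, is_height_fun (U n)) -> (\forall n \near \oo, is_height_fun (V n)) ->
  (forall x y : R, 0 <= x <= 1 -> 0 <= y <= 1 -> U n x y @[n --> \oo] --> H x y) ->
  (forall x y : R, 0 <= x <= 1 -> 0 <= y <= 1 -> V n x y @[n --> \oo] --> K x y) ->
  eps @ \oo --> (0 : R) ->
  forall x y : R, 0 <= x <= 1 -> 0 <= y <= 1 ->
  (\forall n \near \oo,
     (forall g : R, 0 <= g <= 1 -> W n x y <= U n g y + V n x g + eps n) /\
     exists2 g : R, 0 <= g <= 1 & U n g y + V n x g <= W n x y + eps n) ->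
  W n x y @[n --> \oo] --> M x y.
Proof.
move=> /minplusP hM hH hK hU hV UH VK eps0 x y x01 y01 hW.
have [le_M [g g01 ME]] := hM x y x01 y01.
(* The two bounds use at most five errors of size [d]: two from convergence at the tested point, two
   from rounding [g'], one from [eps n]. *)
apply/cvgrPdist_le => /= e e0; pose d := e / 10; have d0 : 0 < d by rewrite divr_gt0.
have de : e = 10 * d by rewrite /d; field.
have [N _ /(_ N (leqnn N)) Nd] := near_infty_natSinv_lt (PosNum d0).
pose r (i : 'I_N.+2) : R := i%:R / N.+1%:R.
have r01 i : 0 <= r i <= 1.
  by rewrite divr_ge0 //= ler_pdivrMr // mul1r ler_nat -ltnS.
have UH_le a b : 0 <= a <= 1 -> 0 <= b <= 1 -> \forall n \near \oo, `|H a b - U n a b| <= d.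
  by move=> a01 b01; have /cvgrPdist_le/(_ d d0) := UH a b a01 b01.
have VK_le a b : 0 <= a <= 1 -> 0 <= b <= 1 -> \forall n \near \oo, `|K a b - V n a b| <= d.
  by move=> a01 b01; have /cvgrPdist_le/(_ d d0) := VK a b a01 b01.
have UG : \forall n \near \oo, forall i, `|H (r i) y - U n (r i) y| <= d.
  by apply: filter_forall => i; exact: UH_le.
have VG : \forall n \near \oo, forall i, `|K x (r i) - V n x (r i)| <= d.
  by apply: filter_forall => i; exact: VK_le.
have Ug := UH_le g y g01 y01; have Vg := VK_le x g x01 g01.
have eps_le : \forall n \near \oo, eps n <= d.
  have /cvgrPdist_le/(_ d d0) := eps0; apply: filterS => n.
  by rewrite sub0r normrN => /(le_trans (ler_norm _)).
near=> n.
have hUn : is_height_fun (U n) by near: n; exact: hU.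
have hVn : is_height_fun (V n) by near: n; exact: hV.
have epsn : eps n <= d by near: n; exact: eps_le.
have [ub [g' g'01 lb]] : (forall g : R, 0 <= g <= 1 -> W n x y <= U n g y + V n x g + eps n) /\
     exists2 g : R, 0 <= g <= 1 & U n g y + V n x g <= W n x y + eps n.
  by near: n; exact: hW.
have h1 := ub g g01.
have h2 : `|H g y - U n g y| <= d by near: n; exact: Ug.
have h3 : `|K x g - V n x g| <= d by near: n; exact: Vg.
have [i [_ gi]] := unit_grid_approx (ltn0Sn N) g'01.
rewrite -/(r i) in gi.
have h4 : `|H (r i) y - U n (r i) y| <= d by move: (i); near: n; exact: UG.
have h5 : `|K x (r i) - V n x (r i)| <= d by move: (i); near: n; exact: VG.
have h6 := height_fun_dist hUn g'01 (r01 i) y01 y01.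
have h7 := height_fun_dist hVn x01 x01 g'01 (r01 i).
have h8 := le_M (r i) (r01 i).
rewrite subrr normr0 addr0 in h6; rewrite subrr normr0 add0r in h7.
have {}Nd : N.+1%:R^-1 <= d by exact: ltW.
have {}h6 := le_trans h6 (le_trans gi Nd).
have {}h7 := le_trans h7 (le_trans gi Nd).
rewrite ME in h8 *; rewrite de; move: h1 lb h2 h3 h4 h5 h6 h7 h8 epsn; rewrite !ler_norml.
move: (W n x y) (U n g y) (V n x g) (U n g' y) (V n x g') (U n (r i) y) (V n x (r i)).
move: (H g y) (K x g) (H (r i) y) (K x (r i)) (eps n) (d); clear.
by move=> Hg Kg Hr Kr e d w Ug Vg Ug' Vg' Ur Vr; lra.
Unshelve. all: end_near. Qed.

End Limit.

Theorem proposition3p2 (R : realType) (mu nu : probability (plane R) R)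
    (hmu : is_permuton mu) (hnu : is_permuton nu) :
  exists rho : probability (plane R) R,
    [/\ is_demazure_permuton mu nu rho,
        forall rho' : probability (plane R) R,
          is_demazure_permuton mu nu rho' ->
          forall A : set (plane R), measurable A -> rho' A = rho A &
        forall u v : (forall n : nat, 'S_n),
          weak_cvg (fun n => perm_permuton (u n)) mu ->
          weak_cvg (fun n => perm_permuton (v n)) nu ->
          weak_cvg (fun n => perm_permuton (demazure (u n) (v n))) rho].
Proof.
have umu : uniform_marginals mu := hmu; have unu : uniform_marginals nu := hnu.
have Hmu := fheight_is_height_fun umu; have Hnu := fheight_is_height_fun unu.
have [M minM] := minplus_exists Hmu Hnu.
have HM := minplus_height_fun Hmu Hnu minM.
have [rho [hrho rhoE]] := height_fun_permuton HM.
have min_rho x y : 0 <= x <= 1 -> 0 <= y <= 1 ->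
    is_min [set (height mu g y + height nu x g)%E | g in `[0, 1]] (height rho x y).
  move=> x01 y01; have [lb [g g01 ME]] := minplusP minM x01 y01; rewrite rhoE //.
  split; first by exists g; rewrite /= ?in_itv // !fheightE // -EFinD ME.
  move=> _ [g' /= g'01 <-]; rewrite in_itv /= in g'01.
  by rewrite !fheightE // -EFinD lee_fin lb.
exists rho; split.
- by split.
(* Both heights are minima of the same set, hence equal, and heights determine a permuton. *)
- move=> rho' [hrho' min_rho'] A mA; apply: permuton_unique => // x y x01 y01.
  have [mem lb] := min_rho x y x01 y01; have [mem' lb'] := min_rho' x y x01 y01.
  by apply/eqP; rewrite eq_le lb' // lb.
move=> u v umuE vnuE.
have unif (w : forall n : nat, 'S_n) :
    \forall n \near \oo, uniform_marginals (perm_permuton (R := R) (w n)).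
  (* Index 0 is excluded: the measure attached to the permutation of the empty set is zero. *)
  by exists 1%N => // n /= n0; exact: perm_permuton_uniform.
have urho : uniform_marginals rho := hrho.
apply: (cvg_fheight_weak urho (unif (fun n => demazure (u n) (v n)))) => x y x01 y01.
have -> : fheight rho x y = M x y by rewrite /fheight [X in fine X]rhoE.
have eps0 : (6 * n%:R^-1 : R) @[n --> \oo] --> (0 : R).
  rewrite -(mulr0 6); apply: cvgM; first exact: cvg_cst.
  by rewrite -cvg_shiftS; exact: cvg_harmonic.
have hunif (w : forall n : nat, 'S_n) :
    \forall n \near \oo, is_height_fun (fheight (perm_permuton (R := R) (w n))).
  by apply: filterS (unif w) => n; exact: fheight_is_height_fun.
apply: (minplus_cvg (W := fun n => fheight (perm_permuton (demazure (u n) (v n))))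
  minM Hmu Hnu (hunif u) (hunif v) _ _ eps0 x01 y01).
- by move=> a b a01 b01; exact: (weak_cvg_fheight umu (unif u) umuE).
- by move=> a b a01 b01; exact: (weak_cvg_fheight unu (unif v) vnuE).
by exists 1%N => // n /= n0; exact: demazure_fheight.
Qed.
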